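(* Let $d\ge3$ and let $T^d$ be the infinite $d$-regular tree. For every exhaustion $V_1\subset V_2\subset\cdots$ of the vertex set of $T^d$, $\nu_{G_n}\Rightarrow\nu$ for a unique probability measure $\nu$ on $\{0,1,\dots,d-1\}^{V(T^d)}$ that does not depend on the exhaustion.
   Context: An exhaustion is a sequence of finite vertex sets $V_1\subset V_2\subset\cdots$ with union the whole vertex set. $G_n$ is the wired graph obtained from $T^d$ by identifying all vertices outside $V_n$ to a single sink $s$ and removing loops at $s$. $\nu_{G_n}$ is the stationary distribution of the Abelian sandpile Markov chain on $G_n$ with sink $s$ (uniform on recurrent configurations; a vertex $x$ with at least $\deg(x)=d$ particles topples by sending one particle to each neighbour, particles sent to $s$ being lost; the chain adds a particle at a random vertex of $V_n$ and stabilizes). Weak convergence $\Rightarrow$ means convergence of the joint law of $(\eta_x)_{x\in A}$ for every finite vertex set $A$. *)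

(* Defs.v *)
From Stdlib Require Import Reals List Arith Bool.
Import ListNotations.
Open Scope R_scope.
Open Scope bool_scope.

(** * The d-regular tree T^d
    Vertices: reduced words over the alphabet {0,..,d-1} (no two consecutive
    equal letters), i.e. the Cayley graph of the free product of d copies of Z/2.
    Adjacency: u ~ v iff one is obtained from the other by appending one letter. *)
Fixpoint reduced (d : nat) (l : list nat) : Prop :=
  match l with
  | [] => True
  | a :: t => (a < d)%nat /\
              match t with [] => True | b :: _ => a <> b end /\
              reduced d t
  end.

Definition leqb (u v : list nat) : bool :=
  if list_eq_dec Nat.eq_dec u v then true else false.

Definition child_of (u v : list nat) : bool :=
  Nat.eqb (length v) (S (length u)) && leqb (firstn (length u) v) u.

Definition adjb (u v : list nat) : bool := child_of u v || child_of v u.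

Definition adj (d : nat) (u v : list nat) : Prop :=
  reduced d u /\ reduced d v /\ exists a, v = u ++ [a] \/ u = v ++ [a].

(** * Sandpile on the wired graph G_n
    A finite vertex set V_n is given as a list of vertices.  Configurations are
    functions (list nat -> nat); those of the chain are supported on V_n. *)
Definition inVb (Vn : list (list nat)) (w : list nat) : bool :=
  existsb (leqb w) Vn.

(* toppling at x: x loses d, each neighbour inside V_n gains one;
   particles sent to the sink (the neighbours outside V_n) are lost *)
Definition topple (d : nat) (Vn : list (list nat)) (x : list nat)
  (eta : list nat -> nat) : list nat -> nat :=
  fun w => if leqb w x then (eta x - d)%nat
           else if adjb x w && inVb Vn w then S (eta w) else eta w.

Definition add_particle (x : list nat) (eta : list nat -> nat) : list nat -> nat :=
  fun w => if leqb w x then S (eta w) else eta w.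

Definition stable (d : nat) (Vn : list (list nat)) (eta : list nat -> nat) : Prop :=
  forall w, In w Vn -> (eta w < d)%nat.

Definition supported (Vn : list (list nat)) (eta : list nat -> nat) : Prop :=
  forall w, ~ In w Vn -> eta w = 0%nat.

Inductive stabilizes (d : nat) (Vn : list (list nat)) :
  (list nat -> nat) -> (list nat -> nat) -> Prop :=
| stab_done : forall eta, stable d Vn eta -> stabilizes d Vn eta eta
| stab_topple : forall eta zeta x, In x Vn -> (d <= eta x)%nat ->
    stabilizes d Vn (topple d Vn x eta) zeta -> stabilizes d Vn eta zeta.

(* one step of the sandpile Markov chain with positive probability:
   add a particle at some vertex of V_n and stabilize *)
Definition chain_step (d : nat) (Vn : list (list nat)) (eta zeta : list nat -> nat) : Prop :=
  exists x, In x Vn /\ stabilizes d Vn (add_particle x eta) zeta.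

Inductive reach (d : nat) (Vn : list (list nat)) :
  (list nat -> nat) -> (list nat -> nat) -> Prop :=
| reach_refl : forall eta, reach d Vn eta eta
| reach_step : forall eta xi zeta, chain_step d Vn eta xi -> reach d Vn xi zeta ->
    reach d Vn eta zeta.

Definition recurrent (d : nat) (Vn : list (list nat)) (eta : list nat -> nat) : Prop :=
  stable d Vn eta /\ supported Vn eta /\
  forall zeta, reach d Vn eta zeta -> reach d Vn zeta eta.

Definition agreeb (A : list (list nat)) (eta xi : list nat -> nat) : bool :=
  forallb (fun w => Nat.eqb (eta w) (xi w)) A.

Definition unif_cyl (Rset : (list nat -> nat) -> Prop) (A : list (list nat))
  (xi : list nat -> nat) (p : R) : Prop :=
  exists L : list (list nat -> nat),
    NoDup L /\ (forall eta, In eta L <-> Rset eta) /\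
    p = INR (length (filter (fun eta => agreeb A eta xi) L)) / INR (length L).

Definition Omega (d : nat) : Type :=
  { eta : list nat -> nat |
    (forall w, reduced d w -> (eta w < d)%nat) /\
    (forall w, ~ reduced d w -> eta w = 0%nat) }.

Inductive measurable (d : nat) : (Omega d -> Prop) -> Prop :=
| meas_coord : forall w k, measurable d (fun eta => proj1_sig eta w = k)
| meas_compl : forall S, measurable d S -> measurable d (fun eta => ~ S eta)
| meas_union : forall S : nat -> Omega d -> Prop, (forall n, measurable d (S n)) ->
    measurable d (fun eta => exists n, S n eta).

Definition is_probability (d : nat) (mu : (Omega d -> Prop) -> R) : Prop :=
  (forall S, measurable d S -> 0 <= mu S) /\
  mu (fun _ => True) = 1 /\
  (forall S : nat -> Omega d -> Prop,
     (forall n, measurable d (S n)) ->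
     (forall i j eta, i <> j -> S i eta -> S j eta -> False) ->
     infinite_sum (fun n => mu (S n)) (mu (fun eta => exists n, S n eta))).

Definition cyl (d : nat) (A : list (list nat)) (xi : list nat -> nat) : Omega d -> Prop :=
  fun eta => forall w, In w A -> proj1_sig eta w = xi w.

Definition exhaustion (d : nat) (V : nat -> list (list nat)) : Prop :=
  (forall n w, In w (V n) -> reduced d w) /\
  (forall n w, In w (V n) -> In w (V (S n))) /\
  (forall w, reduced d w -> exists n, In w (V n)).

Definition sandpile_converges (d : nat) (V : nat -> list (list nat))
  (nu : (Omega d -> Prop) -> R) : Prop :=
  forall (A : list (list nat)) (xi : list nat -> nat),
    (forall w, In w A -> reduced d w) ->
    exists p : nat -> R,
      (forall n, unif_cyl (recurrent d (V n)) A xi (p n)) /\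
      Un_cv p (nu (cyl d A xi)).

(* Main.v *)
(** In a stable recurrent configuration of a finite piece of the tree, burn the sink and let the
    fire spread.  Call a vertex weak if it burns only after its parent.  Recurrence says exactly
    that every vertex carries at least as many particles as it has weak children, so recurrent
    configurations are counted by a recursion from the leaves to the root.  For a uniform
    configuration on the branch above a vertex [c], given that the parent of [c] burns, let
    [p_c] be the probability that [c] is not weak.  Then [p_c = s / (1 + s)] where [s] is the sum
    of [p_j] over the [d - 1] children [j], and [p_c = 1] outside the piece.  This recursion
    contracts to [(d - 2) / (d - 1)], hence all cylinder probabilities converge to limits that do
    not depend on the exhaustion.  The limits are consistent and define a probability measure,
    realized as the image of Lebesgue measure on [0, 1) under nested interval partitions. *)

(* [recurrent] is defined by reachability in the chain, which cannot be counted as it stands; the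
   bridge is Dhar's local criterion, [allowed]. Its hard half, that every allowed stable
   configuration is reachable, comes from adding to it the Laplacian of a large superharmonic
   function and toppling back. The sets [V n] need not be connected. A vertex outside is part of the
   sink, hence never weak, but the branches below it still count. This wired boundary starts the
   recursion at 1, above its fixed point. Monotonicity then keeps every probability above the fixed
   point for any piece whatever, and only the upper bound asks that [V n] be large around the
   vertex. A cylinder constraint changes the recursion at finitely many levels only, so the limit
   passes through it level by level. As the limit is the same along all exhaustions, its positivity
   and consistency can be read off from balls, where they are facts about finite lists. *)
Require Import Defs.
From mathcomp Require all_boot all_order all_algebra all_classical all_reals all_analysis.
From mathcomp Require Rstruct Rstruct_topology.
From Stdlib Require Import Reals List Arith Bool Lia Lra Permutation Cantor.
From Stdlib Require Import FunctionalExtensionality PropExtensionality ClassicalEpsilon.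
Open Scope R_scope.

(** * Lebesgue measure on the unit interval *)

Module UnitLebesgue.
Import all_boot all_order all_algebra all_classical all_reals all_analysis Rstruct Rstruct_topology.
Import Order.TTheory GRing.Theory Num.Theory numFieldNormedType.Exports.
Local Open Scope classical_set_scope.
Local Open Scope ring_scope.

Definition unit_itv : set R := `[0, 1[%classic.
(** Only the trace on [0, 1) counts, so that Lebesgue measure becomes a probability on predicates
    over all of [R]. *)
Definition mes (S : R -> Prop) : Prop := measurable ((S : set (measurableTypeR R)) `&` unit_itv).
Definition mu (S : R -> Prop) : R := fine (lebesgue_measure ((S : set (measurableTypeR R)) `&` unit_itv)).

Lemma in_unit x : unit_itv x <-> (0 <= x < 1)%coqR.
Proof.
rewrite /unit_itv /= in_itv /=; split.
  by move=> /andP[/RleP ? /RltP ?].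
by move=> [? ?]; apply/andP; split; [apply/RleP|apply/RltP].
Qed.

Lemma itvE (a b : R) : (fun x => (a <= x < b)%coqR) = `[a, b[%classic.
Proof.
apply/funext => x; apply/propext; rewrite /= in_itv /=; split.
  by move=> [? ?]; apply/andP; split; [apply/RleP|apply/RltP].
by move=> /andP[/RleP ? /RltP ?].
Qed.

Lemma unit_cap (S S' : R -> Prop) : (forall x, (0 <= x < 1)%coqR -> (S x <-> S' x)) ->
  ((S : set R) `&` unit_itv) = ((S' : set R) `&` unit_itv).
Proof.
move=> h; apply/seteqP; split=> x [Sx ux]; split=> //; by apply/(h x); [apply/in_unit|].
Qed.

Lemma mu_fin (S : R -> Prop) : mes S ->
  lebesgue_measure ((S : set (measurableTypeR R)) `&` unit_itv) \is a fin_num.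
Proof.
move=> mS; rewrite ge0_fin_numE ?measure_ge0 //.
apply: (@le_lt_trans _ _ (lebesgue_measure (unit_itv : set (measurableTypeR R)))).
  apply: le_measure; rewrite ?inE //.
  - exact: measurable_itv.
rewrite /unit_itv lebesgue_measure_itv /= lte_fin ltr01 -EFinB ltry //.
Qed.

Lemma sum_f_R0_big (f : nat -> R) n : sum_f_R0 f n = \sum_(0 <= i < n.+1) f i.
Proof. by elim: n => [|n IH]; rewrite ?big_nat1 //= IH [RHS]big_nat_recr. Qed.

Lemma mu_sigma (S : nat -> R -> Prop) : (forall n, mes (S n)) ->
  (forall i j x, i <> j -> S i x -> S j x -> False) ->
  mes (fun x => exists n, S n x) ->
  infinite_sum (fun n => mu (S n)) (mu (fun x => exists n, S n x)).
Proof.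
move=> mS dS mU.
have E : ((fun x => exists n, S n x) : set R) `&` unit_itv =
   \bigcup_n (((S n) : set R) `&` unit_itv).
  apply/seteqP; split => x; first by move=> [[n Sn] ux]; exists n.
  by move=> [n _ [Sn ux]]; split => //; exists n.
have tS : trivIset setT (fun n => ((S n) : set (measurableTypeR R)) `&` unit_itv).
  apply/trivIsetP => i j _ _ /eqP ij; apply/seteqP; split => // x [[Si _] [Sj _]].
  exact: (dS i j x ij Si Sj).
have := @measure_semi_sigma_additive _ _ _ (@lebesgue_measure R) _ mS tS.
rewrite -E => /(_ mU) cv.
have cvf : (fun n => \sum_(0 <= i < n) mu (S i)) @ \oo --> mu (fun x => exists n, S n x).
  have cv' : (\sum_(0 <= i < n) lebesgue_measure (((S i) : set (measurableTypeR R)) `&` unit_itv))%E @[n --> \oo]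
      --> (mu (fun x => exists n, S n x))%:E.
    by rewrite /mu fineK //; exact: mu_fin.
  have cvH := fine_cvg cv'.
  apply: (cvg_trans _ (cvH _)); apply: near_eq_cvg; near=> n.
  by rewrite /mu /= sum_fine // => i _; exact: mu_fin.
move=> e /RltP e0.
have [N _ HN] := (@cvgrPdist_lt _ R^o _ _ _ _ _).1 cvf e e0.
exists N => n /ssrnat.leP Nn.
rewrite /R_dist sum_f_R0_big.
(* The sum [sum_f_R0 f n] has [n + 1] terms, whence the shift. *)
have := HN n.+1 (leqW Nn); rewrite distrC => /RltP.
by rewrite -RabsE.
Unshelve. all: by end_near. Qed.

(** The interface to the rest of the development: the statement uses Stdlib notions only, so
    MathComp stays inside this module. The first clause allows sets to be replaced by others that
    agree on [0, 1). *)
Lemma unit_lebesgue : exists (mes : (R -> Prop) -> Prop) (mu : (R -> Prop) -> R),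
  (forall S S', (forall x, (0 <= x < 1)%coqR -> (S x <-> S' x)) ->
     (mes S -> mes S') /\ mu S = mu S') /\
  (forall S, mes S -> mes (fun x => ~ S x)) /\
  (forall S : nat -> R -> Prop, (forall n, mes (S n)) -> mes (fun x => exists n, S n x)) /\
  (forall a b, mes (fun x => (a <= x < b)%coqR)) /\
  (forall S, mes S -> (0 <= mu S)%coqR) /\
  (forall a b, (0 <= a)%coqR -> (a <= b)%coqR -> (b <= 1)%coqR ->
     mu (fun x => (a <= x < b)%coqR) = (b - a)%coqR) /\
  (forall S : nat -> R -> Prop, (forall n, mes (S n)) ->
     (forall i j x, i <> j -> S i x -> S j x -> False) ->
     infinite_sum (fun n => mu (S n)) (mu (fun x => exists n, S n x))).
Proof.
have mU (S : nat -> R -> Prop) : (forall n, mes (S n)) -> mes (fun x => exists n, S n x).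
  move=> mS; rewrite /mes.
  have -> : ((fun x => exists n, S n x) : set (measurableTypeR R)) `&` unit_itv =
     \bigcup_n (((S n) : set (measurableTypeR R)) `&` unit_itv).
    apply/seteqP; split => x; first by move=> [[n Sn] ux]; exists n.
    by move=> [n _ [Sn ux]]; split => //; exists n.
  exact: bigcupT_measurable.
exists mes, mu; split; last split; last split; last split; last split; last split.
- move=> S S' h; rewrite /mes /mu; have e := unit_cap _ _ h; split; [by move=> m; rewrite -e|by rewrite e].
- move=> S mS; rewrite /mes.
  have -> : ((fun x => ~ S x) : set (measurableTypeR R)) `&` unit_itv =
    unit_itv `\` ((S : set (measurableTypeR R)) `&` unit_itv).
    apply/seteqP; split => x /=; first by move=> [nS ux]; split => // -[].
    by move=> [ux nS]; split => // Sx; apply: nS.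
  by apply: measurableD => //; exact: measurable_itv.
- exact: mU.
- move=> a b; rewrite /mes itvE; apply: measurableI; exact: measurable_itv.
- by move=> S mS; apply/RleP; rewrite /mu; apply: fine_ge0.
- move=> a b a0 ab b1; rewrite /mu itvE.
  have -> : `[a, b[%classic `&` unit_itv = `[a, b[%classic.
    apply/seteqP; split => x; first by case.
    move=> h; split=> //; apply/in_unit; move: h; rewrite -itvE => -[? ?].
    split; [exact: (Rle_trans _ a)|exact: (Rlt_le_trans _ b)].
  rewrite lebesgue_measure_itv /= lte_fin.
  case: ifP => [_|]; first by rewrite -EFinB.
  move=> /negbT; rewrite -leNgt => /RleP ba /=.
  by rewrite (Rle_antisym _ _ ab ba) Rminus_diag.
- move=> S mS dS; apply: mu_sigma => //; exact: mU.
Qed.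
End UnitLebesgue.

Import ListNotations.

(** * The toppling dynamics *)

Notation vertex := (list nat).

Lemma leqb_iff (u v : vertex) : leqb u v = true <-> u = v.
Proof. unfold leqb. destruct (list_eq_dec Nat.eq_dec u v); split; congruence. Qed.

Lemma leqb_refl (u : vertex) : leqb u u = true.
Proof. now apply leqb_iff. Qed.

Lemma leqb_neq (u v : vertex) : u <> v -> leqb u v = false.
Proof.
  intros H. destruct (leqb u v) eqn:E; [|reflexivity].
  apply leqb_iff in E. contradiction.
Qed.

Lemma inVb_iff (V : list vertex) (w : vertex) : inVb V w = true <-> In w V.
Proof.
  unfold inVb. rewrite existsb_exists. split.
  - intros [x [Hx E]]. apply leqb_iff in E. now subst.
  - intros H. exists w. split; [assumption|apply leqb_refl].
Qed.

Lemma inVb_false (V : list vertex) (w : vertex) : inVb V w = false <-> ~ In w V.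
Proof.
  rewrite <- inVb_iff. destruct (inVb V w); split; congruence.
Qed.

Definition fresh_letter (c : vertex) (a : nat) : bool :=
  match c with [] => true | _ => negb (Nat.eqb (last c 0%nat) a) end.

Definition children (d : nat) (c : vertex) : list vertex :=
  map (fun a => c ++ [a]) (filter (fresh_letter c) (seq 0 d)).

Definition parents (c : vertex) : list vertex :=
  match c with [] => [] | _ => [removelast c] end.

Definition nbrs (d : nat) (c : vertex) : list vertex := children d c ++ parents c.

Lemma reduced_snoc (d : nat) (c : vertex) (a : nat) :
  reduced d (c ++ [a]) <-> reduced d c /\ (a < d)%nat /\ fresh_letter c a = true.
Proof.
  induction c as [|b c IH].
  - simpl. intuition.
  - destruct c as [|b' c].
    + simpl. rewrite negb_true_iff, Nat.eqb_neq. intuition.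
    + change ((b :: b' :: c) ++ [a]) with (b :: ((b' :: c) ++ [a])).
      change (reduced d (b :: (b' :: c) ++ [a])) with
        ((b < d)%nat /\ b <> b' /\ reduced d ((b' :: c) ++ [a])).
      change (reduced d (b :: b' :: c)) with ((b < d)%nat /\ b <> b' /\ reduced d (b' :: c)).
      change (fresh_letter (b :: b' :: c) a) with (fresh_letter (b' :: c) a).
      rewrite IH. intuition.
Qed.

Lemma in_children (d : nat) (c x : vertex) :
  In x (children d c) <-> exists a, x = c ++ [a] /\ (a < d)%nat /\ fresh_letter c a = true.
Proof.
  unfold children. rewrite in_map_iff. split.
  - intros [a [E H]]. apply filter_In in H as [H1 H2]. apply in_seq in H1.
    exists a. intuition (auto; lia).
  - intros [a [E [H1 H2]]]. exists a. split; [congruence|].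
    apply filter_In. split; [apply in_seq; lia|assumption].
Qed.

Lemma in_parents (c x : vertex) : In x (parents c) <-> exists a, c = x ++ [a].
Proof.
  destruct c as [|b c]; simpl parents.
  - split; [intros []|]. intros [a E]. now destruct x.
  - split.
    + intros [H|[]]. exists (last (b :: c) 0%nat). subst x.
      now apply app_removelast_last.
    + intros [a E]. left. change (removelast (b :: c) = x). rewrite E. apply removelast_last.
Qed.

Lemma child_of_iff (u v : vertex) : child_of u v = true <-> exists a, v = u ++ [a].
Proof.
  unfold child_of. rewrite andb_true_iff, Nat.eqb_eq, leqb_iff. split.
  - intros [H1 H2]. rewrite <- (firstn_skipn (length u) v), H2.
    assert (L := length_skipn (length u) v).
    destruct (skipn (length u) v) as [|a [|b l]]; simpl in L; try lia. now exists a.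
  - intros [a ->]. rewrite length_app. simpl. split; [lia|].
    rewrite firstn_app, Nat.sub_diag, firstn_all. simpl. apply app_nil_r.
Qed.

Lemma adjb_nbrs (d : nat) (x w : vertex) : reduced d x -> reduced d w ->
  (adjb x w = true <-> In w (nbrs d x)).
Proof.
  intros Hx Hw. unfold adjb, nbrs.
  rewrite orb_true_iff, !child_of_iff, in_app_iff, in_children, in_parents.
  split; (intros [[a H]|H]; [left|right]); auto.
  - exists a. subst. apply reduced_snoc in Hw. tauto.
  - exists a. tauto.
Qed.

Lemma nbrs_sym (d : nat) (x w : vertex) : reduced d x -> reduced d w ->
  In w (nbrs d x) -> In x (nbrs d w).
Proof.
  intros Hx Hw. rewrite <- !adjb_nbrs by assumption. unfold adjb.
  rewrite !orb_true_iff. tauto.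
Qed.

Lemma snoc_neq (c : vertex) (a : nat) : c ++ [a] <> c.
Proof. intros E. apply (f_equal (@length nat)) in E. rewrite length_app in E. simpl in E. lia. Qed.

Lemma self_not_nbr (d : nat) (x : vertex) : ~ In x (nbrs d x).
Proof.
  unfold nbrs. rewrite in_app_iff, in_children, in_parents.
  intros [[a [E _]]|[a E]]; symmetry in E; now apply snoc_neq in E.
Qed.

Lemma NoDup_children (d : nat) (c : vertex) : NoDup (children d c).
Proof.
  apply FinFun.Injective_map_NoDup.
  - intros a b E. apply app_inv_head in E. congruence.
  - apply NoDup_filter, seq_NoDup.
Qed.

Lemma NoDup_nbrs (d : nat) (c : vertex) : NoDup (nbrs d c).
Proof.
  apply NoDup_app; [apply NoDup_children| |].
  - destruct c; repeat constructor. now intros [].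
  - intros x H1 H2. apply in_children in H1 as [a [-> _]].
    apply in_parents in H2 as [b E]. apply (f_equal (@length nat)) in E.
    rewrite !length_app in E. simpl in E. lia.
Qed.

Definition nsum (u : vertex -> nat) (l : list vertex) : nat := list_sum (map u l).

Lemma nsum_ext (u v : vertex -> nat) (l : list vertex) :
  (forall x, In x l -> u x = v x) -> nsum u l = nsum v l.
Proof.
  intros H. unfold nsum. f_equal. now apply map_ext_in.
Qed.

Lemma nsum_le (u v : vertex -> nat) (l : list vertex) :
  (forall x, In x l -> (u x <= v x)%nat) -> (nsum u l <= nsum v l)%nat.
Proof.
  unfold nsum. induction l as [|y l IH]; simpl; intros H; [lia|].
  specialize (IH (fun x h => H x (or_intror h))).
  specialize (H y (or_introl eq_refl)). lia.
Qed.

Lemma nsum_lt (u v : vertex -> nat) (l : list vertex) (y : vertex) :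
  (forall x, (u x <= v x)%nat) -> In y l -> (u y < v y)%nat -> (nsum u l < nsum v l)%nat.
Proof.
  intros H. unfold nsum. induction l as [|z l IH]; simpl; [tauto|].
  intros [->|Hy] Hlt.
  - assert (L := nsum_le u v l (fun x _ => H x)). unfold nsum in L. lia.
  - specialize (IH Hy Hlt). specialize (H z). lia.
Qed.

Lemma nsum_decr (u u' : vertex -> nat) (x : vertex) (l : list vertex) : NoDup l ->
  (forall y, y <> x -> u' y = u y) -> u x = S (u' x) ->
  nsum u l = (nsum u' l + if inVb l x then 1 else 0)%nat.
Proof.
  intros ND H Hx. unfold nsum. induction ND as [|y l Hy ND IH]; [reflexivity|].
  simpl. rewrite IH. destruct (leqb x y) eqn:E; simpl.
  - apply leqb_iff in E. subst y. apply inVb_false in Hy. rewrite Hy. lia.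
  - assert (x <> y) by (intros ->; now rewrite leqb_refl in E).
    rewrite (H y) by congruence. rewrite ?orb_false_l. fold (inVb l x). destruct (inVb l x); lia.
Qed.

Lemma nsum_const (k : nat) (l : list vertex) : nsum (fun _ => k) l = (k * length l)%nat.
Proof. unfold nsum. induction l; simpl; lia. Qed.

Lemma nsum_app (u : vertex -> nat) (l1 l2 : list vertex) :
  nsum u (l1 ++ l2) = (nsum u l1 + nsum u l2)%nat.
Proof. unfold nsum. now rewrite map_app, list_sum_app. Qed.

Lemma count_avoiding (b d : nat) : (b < d)%nat ->
  length (filter (fun a => negb (Nat.eqb b a)) (seq 0 d)) = (d - 1)%nat.
Proof.
  intros Hb.
  assert (Hin : In b (seq 0 d)) by (apply in_seq; lia).
  assert (ND := seq_NoDup d 0).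
  assert (L := length_seq d 0).
  apply in_split in Hin as [l1 [l2 E]]. rewrite E in *. clear E.
  apply NoDup_remove_2 in ND.
  assert (F : forall l, ~ In b l -> filter (fun a => negb (Nat.eqb b a)) l = l).
  { induction l as [|y l IH]; intros Hl; [reflexivity|]. simpl.
    destruct (Nat.eqb_spec b y) as [->|]; [exfalso; apply Hl; now left|].
    simpl. f_equal. apply IH. intros ?. apply Hl. now right. }
  rewrite filter_app. simpl. rewrite Nat.eqb_refl. simpl.
  rewrite !F by (intros ?; apply ND, in_or_app; tauto).
  rewrite length_app in *. simpl in L. lia.
Qed.

Lemma reduced_last (d : nat) (c : vertex) : reduced d c -> c <> [] -> (last c 0 < d)%nat.
Proof.
  intros Hc Hn. rewrite (app_removelast_last 0%nat Hn) in Hc.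
  apply reduced_snoc in Hc. tauto.
Qed.

Lemma length_children_root (d : nat) : length (children d []) = d.
Proof.
  unfold children. rewrite length_map.
  change (fresh_letter []) with (fun _ : nat => true). now rewrite filter_true, length_seq.
Qed.

Lemma length_children (d : nat) (c : vertex) : reduced d c -> c <> [] ->
  length (children d c) = (d - 1)%nat.
Proof.
  intros Hc Hn. unfold children. rewrite length_map.
  destruct c as [|b c]; [congruence|].
  apply count_avoiding. now apply reduced_last.
Qed.

Lemma length_nbrs (d : nat) (c : vertex) : (1 <= d)%nat -> reduced d c -> length (nbrs d c) = d.
Proof.
  intros Hd Hc. unfold nbrs. rewrite length_app.
  destruct c as [|b c].
  - rewrite length_children_root. simpl. lia.
  - rewrite length_children by (auto; discriminate). simpl. lia.
Qed.

(** * Legal topplings and the abelian property *)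

Definition within (d : nat) (V : list vertex) : Prop := forall w, In w V -> reduced d w.

Lemma topple_self (d : nat) (V : list vertex) (x : vertex) (eta : vertex -> nat) :
  topple d V x eta x = (eta x - d)%nat.
Proof. unfold topple. now rewrite leqb_refl. Qed.

Lemma topple_other (d : nat) (V : list vertex) (x w : vertex) (eta : vertex -> nat) : w <> x ->
  topple d V x eta w = (eta w + if adjb x w && inVb V w then 1 else 0)%nat.
Proof.
  intros H. unfold topple. rewrite leqb_neq by assumption.
  destruct (adjb x w && inVb V w); lia.
Qed.

(** Both topplings are legal, so the truncated subtraction of [d] is exact and commutes with the
    arrival of a particle. *)
Lemma topple_comm (d : nat) (V : list vertex) (x y : vertex) (eta : vertex -> nat) :
  x <> y -> (d <= eta x)%nat -> (d <= eta y)%nat ->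
  topple d V x (topple d V y eta) = topple d V y (topple d V x eta).
Proof.
  intros Hxy Hx Hy. apply functional_extensionality. intros w.
  destruct (list_eq_dec Nat.eq_dec w x) as [->|Hwx].
  - rewrite topple_self, !topple_other, topple_self by assumption.
    destruct (adjb y x && inVb V x); lia.
  - destruct (list_eq_dec Nat.eq_dec w y) as [->|Hwy].
    + rewrite topple_self, !topple_other, topple_self by congruence.
      rewrite topple_other by assumption. destruct (adjb x y && inVb V y); lia.
    + rewrite !topple_other by assumption.
      destruct (adjb x w && inVb V w), (adjb y w && inVb V w); lia.
Qed.

Lemma topple_mono (d : nat) (V : list vertex) (x w : vertex) (eta : vertex -> nat) : w <> x ->
  (eta w <= topple d V x eta w)%nat.
Proof. intros H. rewrite topple_other by assumption. lia. Qed.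

Lemma stabilizes_stable (d : nat) (V : list vertex) (eta zeta : vertex -> nat) :
  stabilizes d V eta zeta -> stable d V zeta.
Proof. induction 1; auto. Qed.

Lemma stabilizes_supported (d : nat) (V : list vertex) (eta zeta : vertex -> nat) :
  stabilizes d V eta zeta -> supported V eta -> supported V zeta.
Proof.
  induction 1 as [|eta zeta x Hx Hd H IH]; auto. intros S. apply IH.
  intros w Hw. rewrite topple_other by congruence.
  apply inVb_false in Hw as Hf. rewrite Hf, andb_false_r, S by assumption. lia.
Qed.

Lemma stabilizes_of_stable (d : nat) (V : list vertex) (eta zeta : vertex -> nat) :
  stabilizes d V eta zeta -> stable d V eta -> zeta = eta.
Proof.
  intros [|? ? x Hx Hd]; auto. intros S. specialize (S x Hx). lia.
Qed.

(** The number of topplings is recorded so that induction on it survives a reordering of the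
    sequence. *)
Inductive stabilizes_in (d : nat) (V : list vertex) : nat -> (vertex -> nat) -> (vertex -> nat) -> Prop :=
| stab_in_done : forall eta, stable d V eta -> stabilizes_in d V 0 eta eta
| stab_in_topple : forall n eta zeta x, In x V -> (d <= eta x)%nat ->
    stabilizes_in d V n (topple d V x eta) zeta -> stabilizes_in d V (S n) eta zeta.

Lemma stabilizes_in_iff (d : nat) (V : list vertex) (eta zeta : vertex -> nat) :
  stabilizes d V eta zeta <-> exists n, stabilizes_in d V n eta zeta.
Proof.
  split.
  - induction 1 as [|? ? x ? ? ? [n IH]]; [exists 0%nat|exists (S n)]; econstructor; eauto.
  - intros [n H]. induction H; econstructor; eauto.
Qed.

(** The abelian property as an exchange: [y] stays unstable until it topples, and the end is stable,
    so [y] topples at some time; this toppling commutes with all earlier ones and moves to the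
    front. *)
Lemma stabilizes_in_first (d : nat) (V : list vertex) (n : nat) (eta zeta : vertex -> nat) (y : vertex) :
  stabilizes_in d V n eta zeta -> In y V -> (d <= eta y)%nat ->
  exists m, n = S m /\ stabilizes_in d V m (topple d V y eta) zeta.
Proof.
  intros H. revert y. induction H as [eta S|n eta zeta x Hx Hd H IH]; intros y Hy Hyd.
  - specialize (S y Hy). lia.
  - exists n. split; [reflexivity|].
    destruct (list_eq_dec Nat.eq_dec x y) as [->|Hxy]; [assumption|].
    destruct (IH y Hy) as [m [-> Hm]].
    + etransitivity; [exact Hyd|apply topple_mono; congruence].
    + apply stab_in_topple with x; auto.
      * etransitivity; [exact Hd|apply topple_mono; congruence].
      * now rewrite topple_comm.
Qed.

Definition add_all (ps : list vertex) (eta : vertex -> nat) : vertex -> nat :=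
  fold_right add_particle eta ps.

Lemma add_particle_le (x w : vertex) (eta : vertex -> nat) : (eta w <= add_particle x eta w)%nat.
Proof. unfold add_particle. destruct (leqb w x); lia. Qed.

Lemma add_all_le (ps : list vertex) (w : vertex) (eta : vertex -> nat) : (eta w <= add_all ps eta w)%nat.
Proof.
  induction ps as [|p ps IH]; simpl; [lia|].
  etransitivity; [exact IH|apply add_particle_le].
Qed.

Lemma topple_add (d : nat) (V : list vertex) (x p : vertex) (eta : vertex -> nat) :
  (d <= eta x)%nat ->
  topple d V x (add_particle p eta) = add_particle p (topple d V x eta).
Proof.
  intros Hd. apply functional_extensionality. intros w.
  unfold topple, add_particle. destruct (leqb w x) eqn:E1.
  - apply leqb_iff in E1. subst w.
    destruct (leqb x p); lia.
  - destruct (leqb w p), (adjb x w && inVb V w); lia.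
Qed.

Lemma topple_add_all (d : nat) (V : list vertex) (x : vertex) (ps : list vertex) (eta : vertex -> nat) :
  (d <= eta x)%nat -> topple d V x (add_all ps eta) = add_all ps (topple d V x eta).
Proof.
  intros Hd. induction ps as [|p ps IH]; [reflexivity|]. simpl.
  rewrite topple_add, IH; [reflexivity|]. etransitivity; [exact Hd|apply add_all_le].
Qed.

(* That [sigma] can be stabilized at all follows from the length of the given sequence. *)
Lemma stabilize_before_adding (d : nat) (V : list vertex) (ps : list vertex) (n : nat)
  (sigma eta : vertex -> nat) : stabilizes_in d V n (add_all ps sigma) eta ->
  exists sigma', stabilizes d V sigma sigma' /\ stabilizes d V (add_all ps sigma') eta.
Proof.
  revert sigma. induction n as [|n IH]; intros sigma H.
  - exists sigma. split.
    + constructor. inversion H as [? S|]; subst. intros w Hw. specialize (S w Hw).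
      assert (L := add_all_le ps w sigma). lia.
    + apply stabilizes_in_iff. eauto.
  - destruct (existsb (fun x => Nat.leb d (sigma x)) V) eqn:E.
    + apply existsb_exists in E as [x [Hx Hd]]. apply Nat.leb_le in Hd.
      destruct (stabilizes_in_first _ _ _ _ _ x H Hx) as [m [E Hm]].
      { etransitivity; [exact Hd|apply add_all_le]. }
      injection E as <-. rewrite topple_add_all in Hm by assumption.
      destruct (IH _ Hm) as [s [H1 H2]]. exists s. split; [|assumption].
      now apply stab_topple with x.
    + exists sigma. split; [|apply stabilizes_in_iff; eauto].
      constructor. intros w Hw. destruct (Nat.lt_ge_cases (sigma w) d) as [|L]; [assumption|].
      exfalso. apply Bool.not_true_iff_false in E. apply E, existsb_exists.
      exists w. split; [assumption|now apply Nat.leb_le].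
Qed.

(** Adding many particles and stabilizing once is a path of the chain: peel off one particle,
    stabilize it before the others arrive, and recurse. *)
Lemma reach_adding (d : nat) (V : list vertex) (ps : list vertex) (sigma eta : vertex -> nat) :
  incl ps V -> stable d V sigma -> stabilizes d V (add_all ps sigma) eta -> reach d V sigma eta.
Proof.
  revert sigma. induction ps as [|p ps IH]; intros sigma Hi Hs H.
  - simpl in H. rewrite (stabilizes_of_stable _ _ _ _ H Hs). constructor.
  - assert (E : forall l, add_particle p (add_all l sigma) = add_all l (add_particle p sigma)).
    { induction l as [|q l IHl]; [reflexivity|]. simpl. rewrite <- IHl.
      apply functional_extensionality. intros w. unfold add_particle.
      now destruct (leqb w p), (leqb w q). }
    simpl in H. rewrite E in H. apply stabilizes_in_iff in H as [n H].
    destruct (stabilize_before_adding _ _ _ _ _ _ H) as [s [H1 H2]].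
    apply reach_step with s.
    + exists p. split; [apply Hi; now left|assumption].
    + apply IH; auto.
      * intros q Hq. apply Hi. now right.
      * now apply stabilizes_stable in H1.
Qed.

Lemma add_all_app (l1 l2 : list vertex) (eta : vertex -> nat) :
  add_all (l1 ++ l2) eta = add_all l1 (add_all l2 eta).
Proof. apply fold_right_app. Qed.

Lemma exists_particles (V : list vertex) (sigma alpha : vertex -> nat) :
  (forall w, (sigma w <= alpha w)%nat) -> (forall w, ~ In w V -> sigma w = alpha w) ->
  exists ps, incl ps V /\ alpha = add_all ps sigma.
Proof.
  revert sigma. induction V as [|v V IH]; intros sigma Hle Hout.
  - exists []. split; [intros ? []|]. apply functional_extensionality.
    intros w. symmetry. now apply Hout.
  - set (sigma' := fun w => if leqb w v then alpha w else sigma w).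
    destruct (IH sigma') as [ps [Hi E]].
    + intros w. unfold sigma'. destruct (leqb w v); auto.
    + intros w Hw. unfold sigma'. destruct (leqb w v) eqn:Ev; [reflexivity|].
      apply Hout. intros [->|]; [now rewrite leqb_refl in Ev|contradiction].
    + exists (ps ++ repeat v (alpha v - sigma v)). split.
      * intros x Hx. apply in_app_iff in Hx as [Hx|Hx]; [right; auto|].
        apply repeat_spec in Hx. now left.
      * rewrite add_all_app.
        assert (Er : forall k, add_all (repeat v k) sigma = fun w => if leqb w v then (sigma w + k)%nat else sigma w).
        { intros k. apply functional_extensionality. intros w.
          induction k as [|k IHk]; simpl; [destruct (leqb w v); lia|].
          unfold add_particle. rewrite IHk. destruct (leqb w v); lia. }
        rewrite Er, E at 1. f_equal. apply functional_extensionality. intros w. unfold sigma'.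
        destruct (leqb w v) eqn:Ev; [|reflexivity]. apply leqb_iff in Ev. subst w.
        specialize (Hle v). lia.
Qed.

(** Dhar's criterion: there is no forbidden subconfiguration, that is, no nonempty set in which
    every vertex has fewer particles than neighbours in the set. *)
Definition allowed (d : nat) (V : list vertex) (eta : vertex -> nat) : Prop :=
  forall F : vertex -> bool, (forall x, F x = true -> In x V) -> (exists x, F x = true) ->
    exists x, F x = true /\ (length (filter F (nbrs d x)) <= eta x)%nat.

Lemma exists_max (u : vertex -> nat) (l : list vertex) : l <> [] ->
  exists x, In x l /\ forall y, In y l -> (u y <= u x)%nat.
Proof.
  induction l as [|a l IH]; [congruence|]. intros _.
  destruct l as [|b l].
  - exists a. split; [now left|]. intros y [->|[]]. lia.
  - destruct IH as [x [Hx H]]; [congruence|].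
    destruct (Nat.le_ge_cases (u a) (u x)).
    + exists x. split; [now right|]. intros y [->|Hy]; auto.
    + exists a. split; [now left|]. intros y [->|Hy]; [lia|]. specialize (H y Hy). lia.
Qed.

(* [zeta] is [eta + Delta u] for the toppling matrix [Delta] of the wired graph.  As [eta] is
   allowed, some vertex where [u] is maximal can topple; this lowers [u] by one there. *)
Lemma stabilizes_script (d : nat) (V : list vertex) (eta : vertex -> nat) :
  (1 <= d)%nat -> within d V -> stable d V eta -> supported V eta -> allowed d V eta ->
  forall (n : nat) (u zeta : vertex -> nat), (nsum u V <= n)%nat ->
  supported V u -> supported V zeta ->
  (forall x, In x V -> (zeta x + nsum u (nbrs d x) = eta x + d * u x)%nat) ->
  stabilizes d V zeta eta.
Proof.
  intros Hd HV Hst Hsu Hal n. induction n as [n IH] using lt_wf_ind. intros u zeta Hn Hu Hz Hrel.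
  destruct (existsb (fun x => Nat.ltb 0 (u x)) V) eqn:E.
  - apply existsb_exists in E as [x0 [Hx0 Hpos]]. apply Nat.ltb_lt in Hpos.
    assert (HVn : V <> []) by (intros ->; destruct Hx0).
    destruct (exists_max u V HVn) as [y [Hy Hmax]].
    assert (Hm : (0 < u y)%nat) by (specialize (Hmax x0 Hx0); lia).
    set (F := fun x => inVb V x && Nat.eqb (u x) (u y)).
    destruct (Hal F) as [x [Fx Hx]].
    { intros x Hx. apply andb_true_iff in Hx as [Hx _]. now apply inVb_iff. }
    { exists y. unfold F. apply andb_true_iff. split; [now apply inVb_iff|apply Nat.eqb_refl]. }
    apply andb_true_iff in Fx as [FV Fu]. apply inVb_iff in FV. apply Nat.eqb_eq in Fu.
    (* Off [F] the function [u] is at least one below its maximum, also outside [V], where it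
       vanishes. Hence [zeta x] exceeds [eta x] by at least the number of neighbours of [x] off [F];
       as [eta x] pays for the neighbours in [F], the total is at least [d]. *)
    assert (Hb : forall l, (nsum u l + length l <= u y * length l + length (filter F l))%nat).
    { induction l as [|z l IHl]; [simpl; lia|]. unfold nsum in *. simpl.
      assert (Hz1 : (u z + 1 <= u y + if F z then 1 else 0)%nat).
      { unfold F. destruct (inVb V z) eqn:Ez.
        - apply inVb_iff in Ez. specialize (Hmax z Ez).
          destruct (Nat.eqb_spec (u z) (u y)); simpl; lia.
        - apply inVb_false in Ez. rewrite (Hu z Ez). simpl. lia. }
      destruct (F z); simpl; lia. }
    specialize (Hb (nbrs d x)). rewrite length_nbrs in Hb by auto.
    assert (Hleg : (d <= zeta x)%nat) by (specialize (Hrel x FV); rewrite Fu in Hrel; nia).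
    apply stab_topple with x; [assumption|assumption|].
    set (u' := fun w => if leqb w x then (u x - 1)%nat else u w).
    assert (Hu'x : u x = S (u' x)) by (unfold u'; rewrite leqb_refl; lia).
    assert (Hu'o : forall w, w <> x -> u' w = u w) by (intros w Hw; unfold u'; now rewrite leqb_neq).
    apply IH with (nsum u' V) u'; [|lia| | |].
    + eapply Nat.lt_le_trans; [|exact Hn]. apply nsum_lt with x; [|assumption|lia].
      intros w. destruct (list_eq_dec Nat.eq_dec w x) as [->|Hw]; [lia|]. rewrite Hu'o; auto.
    + intros w Hw. rewrite Hu'o; [auto|congruence].
    + intros w Hw. rewrite topple_other by congruence.
      apply inVb_false in Hw as Hf. rewrite Hf, andb_false_r, Hz by assumption. lia.
    + intros w Hw. specialize (Hrel w Hw).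
      rewrite (nsum_decr u u' x _ (NoDup_nbrs d w) Hu'o Hu'x) in Hrel.
      destruct (list_eq_dec Nat.eq_dec w x) as [->|Hwx].
      * rewrite topple_self.
        rewrite (proj2 (inVb_false _ _) (self_not_nbr d x)) in Hrel. nia.
      * rewrite topple_other by assumption. rewrite Hu'o by assumption.
        assert (Ea : adjb x w && inVb V w = inVb (nbrs d w) x).
        { rewrite (proj2 (inVb_iff V w) Hw), andb_true_r. apply eq_iff_eq_true.
          rewrite adjb_nbrs, inVb_iff by auto. split; apply nbrs_sym; auto. }
        rewrite Ea. lia.
  - replace zeta with eta; [now constructor|]. apply functional_extensionality. intros w.
    assert (Hu0 : forall x, u x = 0%nat).
    { intros x. destruct (in_dec (list_eq_dec Nat.eq_dec) x V) as [Hx|Hx]; [|auto].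
      destruct (u x) eqn:Ex; [reflexivity|]. apply Bool.not_true_iff_false in E.
      exfalso. apply E, existsb_exists. exists x. split; [assumption|].
      apply Nat.ltb_lt. lia. }
    destruct (in_dec (list_eq_dec Nat.eq_dec) w V) as [Hw|Hw].
    + specialize (Hrel w Hw). rewrite Hu0 in Hrel.
      rewrite (nsum_ext u (fun _ => 0%nat)), nsum_const in Hrel by auto. lia.
    + now rewrite Hsu, Hz.
Qed.

Lemma exists_length_bound (V : list vertex) : exists L, forall w, In w V -> (length w < L)%nat.
Proof.
  induction V as [|v V [L H]]; [exists 0%nat; intros ? []|].
  exists (L + S (length v))%nat. intros w [<-|Hw]; [lia|]. specialize (H w Hw). lia.
Qed.

Definition full (d : nat) (V : list vertex) : vertex -> nat :=
  fun w => if inVb V w then (d - 1)%nat else 0%nat.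

(** The condition [a <= b] lets one formula cover the root as well, all of whose [d] neighbours are
    children. *)
Lemma nsum_nbrs_le (d : nat) (x : vertex) (u : vertex -> nat) (a b : nat) : (1 <= d)%nat -> reduced d x ->
  (forall y, In y (children d x) -> (u y <= a)%nat) -> (forall y, In y (parents x) -> (u y <= b)%nat) ->
  (a <= b)%nat ->
  (nsum u (nbrs d x) <= (d - 1) * a + b)%nat.
Proof.
  intros Hd Hx Ha Hb Hab. unfold nbrs. rewrite nsum_app.
  apply nsum_le in Ha, Hb. rewrite nsum_const in Ha, Hb.
  destruct x as [|c x].
  - rewrite length_children_root in Ha. simpl parents in *. simpl in Hb. nia.
  - rewrite length_children in Ha by (auto; discriminate). simpl in Hb |- *. lia.
Qed.

(* [u x = (d - 1) * (L - length x)] is superharmonic because [d >= 3], and its Laplacian is at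
   least [d - 1]: adding it to [eta] dominates [full]. *)
Lemma allowed_reachable (d : nat) (V : list vertex) (eta : vertex -> nat) :
  (3 <= d)%nat -> within d V -> stable d V eta -> supported V eta -> allowed d V eta ->
  reach d V (full d V) eta.
Proof.
  intros Hd HV Hst Hsu Hal.
  destruct (exists_length_bound V) as [L HL].
  set (u := fun x : vertex => if inVb V x then ((d - 1) * (L - length x))%nat else 0%nat).
  (* The truncated subtraction is exact by [Hsuper] below, which also gives room for [full] under
     [alpha]. *)
  set (alpha := fun x => if inVb V x then (eta x + d * u x - nsum u (nbrs d x))%nat else 0%nat).
  assert (Hu : forall y, (u y <= (d - 1) * (L - length y))%nat).
  { intros y. unfold u. destruct (inVb V y); [apply le_n|apply Nat.le_0_l]. }
  assert (Hsuper : forall x, In x V -> (nsum u (nbrs d x) + (d - 1) <= d * u x)%nat).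
  { intros x Hx. specialize (HL x Hx).
    assert (B := nsum_nbrs_le d x u ((d - 1) * (L - S (length x))) ((d - 1) * (L + 1 - length x))).
    replace (u x) with ((d - 1) * (L - length x))%nat
      by (unfold u; now rewrite (proj2 (inVb_iff V x) Hx)).
    assert (B' : (nsum u (nbrs d x) <= (d - 1) * ((d - 1) * (L - S (length x))) + (d - 1) * (L + 1 - length x))%nat).
    { apply B; auto; try lia.
      - intros y Hy. apply in_children in Hy as [a [-> _]]. etransitivity; [apply Hu|].
        rewrite length_app. simpl. apply Nat.mul_le_mono_l. lia.
      - intros y Hy. apply in_parents in Hy as [a ->]. etransitivity; [apply Hu|].
        rewrite length_app in *. simpl in *. apply Nat.mul_le_mono_l. lia.
      - apply Nat.mul_le_mono_l. lia. }
    (* After division by [d - 1] the gap is [d (k + 1) - (d - 1) k - (k + 2) = d - 2], which is at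
       least 1. *)
    clear - B' Hd HL. remember (L - S (length x))%nat as k.
    replace (L - length x)%nat with (S k) by lia.
    replace (L + 1 - length x)%nat with (S (S k)) in B' by lia.
    destruct d as [|[|[|d]]]; simpl Nat.sub in *; nia. }
  assert (Hstab : stabilizes d V alpha eta).
  { apply stabilizes_script with (n := nsum u V) (u := u); auto; try lia.
    - intros w Hw. unfold u. now rewrite (proj2 (inVb_false V w) Hw).
    - intros w Hw. unfold alpha. now rewrite (proj2 (inVb_false V w) Hw).
    - intros x Hx. specialize (Hsuper x Hx). unfold alpha.
      rewrite (proj2 (inVb_iff V x) Hx). lia. }
  destruct (exists_particles V (full d V) alpha) as [ps [Hi E]].
  - intros w. unfold full, alpha. destruct (inVb V w) eqn:E; [|lia].
    apply inVb_iff in E. specialize (Hsuper w E). lia.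
  - intros w Hw. unfold full, alpha. now rewrite (proj2 (inVb_false V w) Hw).
  - apply reach_adding with ps; [assumption| |congruence].
    intros w Hw. unfold full. rewrite (proj2 (inVb_iff V w) Hw). lia.
Qed.

Lemma reach_full (d : nat) (V : list vertex) (eta : vertex -> nat) : (1 <= d)%nat ->
  stable d V eta -> supported V eta -> reach d V eta (full d V).
Proof.
  intros Hd Hst Hsu.
  destruct (exists_particles V eta (full d V)) as [ps [Hi E]].
  - intros w. unfold full. destruct (inVb V w) eqn:Ew.
    + apply inVb_iff in Ew. specialize (Hst w Ew). lia.
    + apply inVb_false in Ew. rewrite Hsu by assumption. lia.
  - intros w Hw. unfold full. rewrite (proj2 (inVb_false V w) Hw). auto.
  - apply reach_adding with ps; auto. rewrite <- E. constructor.
    intros w Hw. unfold full. rewrite (proj2 (inVb_iff V w) Hw). lia.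
Qed.

(** A deepest vertex of a finite set has at most its parent as a neighbour in the set. *)
Lemma allowed_full (d : nat) (V : list vertex) : (2 <= d)%nat -> within d V -> allowed d V (full d V).
Proof.
  intros Hd HV F HF [x0 Hx0].
  destruct (exists_max (@length nat) (filter F V)) as [x [Hx Hmax]].
  - intros E. assert (In x0 (filter F V)) by (apply filter_In; auto). rewrite E in H. destruct H.
  - apply filter_In in Hx as [HxV HFx]. exists x. split; [assumption|].
    unfold full. rewrite (proj2 (inVb_iff V x) HxV). unfold nbrs. rewrite filter_app, length_app.
    assert (Hc : filter F (children d x) = []).
    { assert (N : forall l, (forall y, In y l -> F y = false) -> filter F l = []).
      { induction l as [|z l IH]; intros Hl; [reflexivity|]. simpl.
        rewrite (Hl z) by now left. apply IH. intros. apply Hl. now right. }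
      apply N. intros y Hy. destruct (F y) eqn:Ey; [|reflexivity].
      apply in_children in Hy as [a [-> _]].
      assert (L : In (x ++ [a]) (filter F V)) by (apply filter_In; auto).
      apply Hmax in L. rewrite length_app in L. simpl in L. lia. }
    rewrite Hc. simpl length.
    assert (L := filter_length_le F (parents x)).
    destruct x as [|c x]; simpl parents in *; simpl length in *; lia.
Qed.

(** Test [F] without [x] on the old configuration. The vertex found there may have [x] as one more
    neighbour in [F], but then it has received a particle from [x]. If [F] is just [x], there is no
    neighbour to pay for. *)
Lemma allowed_topple (d : nat) (V : list vertex) (x : vertex) (eta : vertex -> nat) :
  within d V -> In x V -> (d <= eta x)%nat -> allowed d V eta -> allowed d V (topple d V x eta).
Proof.
  intros HV Hx Hd Hal F HF HF0.
  set (G := fun y => F y && negb (leqb y x)).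
  destruct (existsb G V) eqn:E.
  - destruct (Hal G) as [y [Gy Hy]].
    + intros y Gy. apply andb_true_iff in Gy as [Gy _]. auto.
    + apply existsb_exists in E as [y [_ Gy]]. eauto.
    + apply andb_true_iff in Gy as [Fy Hyx]. apply negb_true_iff in Hyx.
      exists y. split; [assumption|].
      assert (Nyx : y <> x) by (intros ->; now rewrite leqb_refl in Hyx).
      rewrite topple_other by assumption.
      assert (HyV := HF y Fy).
      assert (Ea : adjb x y && inVb V y = inVb (nbrs d y) x).
      { rewrite (proj2 (inVb_iff V y) HyV), andb_true_r. apply eq_iff_eq_true.
        rewrite (adjb_nbrs d), inVb_iff by auto. split; apply nbrs_sym; auto. }
      rewrite Ea. etransitivity; [|apply Nat.add_le_mono_r, Hy].
      assert (K : forall l, NoDup l ->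
        (length (filter F l) <= length (filter G l) + if inVb l x then 1 else 0)%nat).
      { induction 1 as [|z l Hz ND IH]; [simpl; lia|]. simpl.
        unfold G at 1. destruct (leqb z x) eqn:Ez.
        - apply leqb_iff in Ez. subst z. rewrite leqb_refl. apply inVb_false in Hz.
          rewrite Hz in IH. rewrite andb_false_r. simpl. destruct (F x); simpl; lia.
        - rewrite leqb_neq by (intros ->; now rewrite leqb_refl in Ez).
          rewrite andb_true_r. simpl. destruct (F z); simpl; fold (inVb l x); destruct (inVb l x); lia. }
      apply K, NoDup_nbrs.
  - assert (HFx : forall y, F y = true -> y = x).
    { intros y Fy. apply leqb_iff. destruct (leqb y x) eqn:Ey; [reflexivity|].
      apply not_true_iff_false in E. exfalso. apply E, existsb_exists. exists y.
      split; [auto|]. unfold G. now rewrite Fy, Ey. }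
    destruct HF0 as [x0 Fx0]. assert (x0 = x) by auto. subst x0.
    exists x. split; [assumption|].
    assert (N : forall l, ~ In x l -> filter F l = []).
    { induction l as [|z l IH]; intros Hl; [reflexivity|]. simpl.
      destruct (F z) eqn:Fz; [exfalso; apply Hl; left; auto|].
      apply IH. intros ?; apply Hl; now right. }
    rewrite N by apply self_not_nbr. simpl. lia.
Qed.

Lemma allowed_mono (d : nat) (V : list vertex) (eta zeta : vertex -> nat) :
  (forall w, (eta w <= zeta w)%nat) -> allowed d V eta -> allowed d V zeta.
Proof.
  intros Hle Hal F HF HF0. destruct (Hal F HF HF0) as [x [Fx Hx]].
  exists x. split; [assumption|]. etransitivity; eauto.
Qed.

Lemma allowed_stabilizes (d : nat) (V : list vertex) (eta zeta : vertex -> nat) :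
  within d V -> stabilizes d V eta zeta -> allowed d V eta -> allowed d V zeta.
Proof. intros HV. induction 1; auto. intros. apply IHstabilizes, allowed_topple; auto. Qed.

Lemma supported_add (V : list vertex) (p : vertex) (eta : vertex -> nat) :
  In p V -> supported V eta -> supported V (add_particle p eta).
Proof.
  intros Hp Hs w Hw. unfold add_particle. rewrite leqb_neq by congruence. auto.
Qed.

Lemma reach_invariant (d : nat) (V : list vertex) (eta zeta : vertex -> nat) : within d V ->
  reach d V eta zeta ->
  (allowed d V eta -> allowed d V zeta) /\
  (stable d V eta /\ supported V eta -> stable d V zeta /\ supported V zeta).
Proof.
  intros HV. induction 1 as [eta|eta xi zeta [p [Hp Hst]] _ [IH1 IH2]]; [tauto|]. split.
  - intros Hal. apply IH1. eapply allowed_stabilizes; eauto.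
    eapply allowed_mono; [|exact Hal]. intros. apply add_particle_le.
  - intros [_ Hs]. apply IH2. split; [now apply stabilizes_stable in Hst|].
    eapply stabilizes_supported; eauto. now apply supported_add.
Qed.

Lemma reach_trans (d : nat) (V : list vertex) (eta xi zeta : vertex -> nat) :
  reach d V eta xi -> reach d V xi zeta -> reach d V eta zeta.
Proof. induction 1; auto. intros. eapply reach_step; eauto. Qed.

(** Everything goes through [full]: each stable configuration leads to it, it is allowed, the chain
    preserves allowedness, and each allowed stable configuration is reached from it. *)
Lemma recurrent_iff_allowed (d : nat) (V : list vertex) (eta : vertex -> nat) :
  (3 <= d)%nat -> within d V ->
  (recurrent d V eta <-> stable d V eta /\ supported V eta /\ allowed d V eta).
Proof.
  intros Hd HV. split.
  - intros [Hst [Hsu Hr]]. repeat split; auto.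
    assert (R : reach d V (full d V) eta) by (apply Hr, reach_full; auto; lia).
    apply reach_invariant in R as [R _]; [|assumption]. apply R, allowed_full; auto; lia.
  - intros [Hst [Hsu Hal]]. repeat split; auto. intros zeta Hz.
    apply reach_invariant in Hz as [_ Hz]; [|assumption].
    apply reach_trans with (full d V).
    + apply reach_full; try tauto. lia.
    + apply allowed_reachable; auto.
Qed.

(** * Weak vertices *)

Lemma reduced_prefix (d : nat) (c s : vertex) : reduced d (c ++ s) -> reduced d c.
Proof.
  revert c. induction s as [|a s IH] using rev_ind; intros c H.
  - now rewrite app_nil_r in H.
  - rewrite app_assoc in H. apply reduced_snoc in H. apply IH. tauto.
Qed.

Lemma children_reduced (d : nat) (c x : vertex) : reduced d c -> In x (children d c) -> reduced d x.
Proof.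
  intros Hc Hx. apply in_children in Hx as [a [-> H]]. apply reduced_snoc. tauto.
Qed.

Lemma filter_length_mono (A : Type) (f g : A -> bool) (l : list A) :
  (forall x, In x l -> f x = true -> g x = true) ->
  (length (filter f l) <= length (filter g l))%nat.
Proof.
  induction l as [|x l IH]; intros H; [simpl; lia|]. simpl.
  assert (Hx := H x (or_introl eq_refl)).
  assert (L := IH (fun y h => H y (or_intror h))).
  destruct (f x); [rewrite Hx by reflexivity; simpl; lia|destruct (g x); simpl; lia].
Qed.

(* [weakb k c]: within depth [k] below [c], the vertex [c] burns only after its parent does. *)
Fixpoint weakb (d : nat) (P : vertex -> bool) (eta : vertex -> nat) (k : nat) (c : vertex) : bool :=
  match k with
  | O => false
  | S k => P c && Nat.leb (eta c) (length (filter (weakb d P eta k) (children d c)))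
  end.

(** The bound of particles by weak children, arranged along the tree so that counting can follow the
    same recursion. The constraint [cst] carries the values prescribed by a cylinder. *)
Fixpoint okb (d : nat) (P : vertex -> bool) (cst : vertex -> nat -> bool) (eta : vertex -> nat)
  (k : nat) (c : vertex) : bool :=
  match k with
  | O => true
  | S k => forallb (okb d P cst eta k) (children d c) &&
           (if P c then cst c (eta c) && Nat.leb (length (filter (weakb d P eta k) (children d c))) (eta c)
            else true)
  end.

(** At [c ++ s] the depth [k - length s] remains, and the children have one less. *)
Lemma okb_iff (d : nat) (P : vertex -> bool) (cst : vertex -> nat -> bool) (eta : vertex -> nat)
  (k : nat) (c : vertex) : reduced d c ->
  (okb d P cst eta k c = true <->
   forall s, (length s < k)%nat -> reduced d (c ++ s) -> P (c ++ s) = true ->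
     cst (c ++ s) (eta (c ++ s)) = true /\
     (length (filter (weakb d P eta (k - S (length s))) (children d (c ++ s))) <= eta (c ++ s))%nat).
Proof.
  revert c. induction k as [|k IH]; intros c Hc; simpl okb.
  - split; [intros _ s Hs; lia|reflexivity].
  - rewrite andb_true_iff, forallb_forall. split.
    + intros [H1 H2] [|a s] Hs Hr HP.
      * rewrite app_nil_r in *. rewrite HP in H2. apply andb_true_iff in H2 as [H2 H3].
        apply Nat.leb_le in H3. change (S k - S (length (@nil nat)))%nat with (k - 0)%nat. rewrite Nat.sub_0_r. auto.
      * replace (c ++ a :: s) with ((c ++ [a]) ++ s) in * by (rewrite <- app_assoc; reflexivity).
        assert (Hca : reduced d (c ++ [a])) by now apply reduced_prefix in Hr.
        apply (IH (c ++ [a]) Hca); auto; [|simpl in Hs; lia].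
        apply H1, in_children. exists a. apply reduced_snoc in Hca. tauto.
    + intros H. split.
      * intros x Hx. assert (Hxr := children_reduced d c x Hc Hx).
        apply IH; [assumption|]. intros s Hs Hr HP.
        apply in_children in Hx as [a [-> _]].
        rewrite <- app_assoc in *. apply (H (a :: s)); auto. simpl. lia.
      * destruct (P c) eqn:E; [|reflexivity].
        destruct (H []) as [H1 H2]; rewrite ?app_nil_r; auto; [simpl; lia|].
        rewrite app_nil_r in *. change (S k - S (length (@nil nat)))%nat with (k - 0)%nat in H2. rewrite Nat.sub_0_r in H2.
        apply andb_true_iff. split; [assumption|now apply Nat.leb_le].
Qed.

(** Descendants joined to [c] by weak vertices; [c] itself belongs to it, weak or not. This is the
    forbidden set if the bound fails at [c]. *)
Inductive weak_cluster (W : vertex -> bool) (c : vertex) : vertex -> Prop :=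
| wc_base : weak_cluster W c c
| wc_step : forall x a, weak_cluster W c x -> W (x ++ [a]) = true -> weak_cluster W c (x ++ [a]).

(** Given an allowed configuration, test the weak cluster of [c]. A vertex of it other than [c] is
    weak and has its parent in the cluster, so it has too few particles; the vertex found is [c],
    and its weak children lie in the cluster. Conversely, all vertices of a forbidden set are weak,
    by induction from the deepest upwards, since the parent accounts for at most one neighbour. A
    topmost vertex has no parent in the set and violates the bound. *)
Lemma allowed_iff_weak_bound (d : nat) (V : list vertex) (eta : vertex -> nat) (W : vertex -> bool) :
  within d V ->
  (forall x, W x = inVb V x && Nat.leb (eta x) (length (filter W (children d x)))) ->
  (allowed d V eta <-> forall c, In c V -> (length (filter W (children d c)) <= eta c)%nat).
Proof.
  intros HV HW.
  assert (HWV : forall x, W x = true -> In x V).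
  { intros x Hx. rewrite HW in Hx. apply andb_true_iff in Hx as [Hx _]. now apply inVb_iff. }
  split.
  - intros Hal c Hc.
    set (F := fun x => if excluded_middle_informative (weak_cluster W c x) then true else false).
    assert (HF : forall x, F x = true <-> weak_cluster W c x).
    { intros x. unfold F. destruct excluded_middle_informative; split; congruence. }
    destruct (Hal F) as [x [Fx Hx]].
    + intros x Fx. apply HF in Fx. destruct Fx; auto.
    + exists c. apply HF. constructor.
    + apply HF in Fx. unfold nbrs in Hx. rewrite filter_app, length_app in Hx.
      assert (L : (length (filter W (children d x)) <= length (filter F (children d x)))%nat).
      { apply filter_length_mono. intros y Hy Wy. apply HF.
        apply in_children in Hy as [a [-> _]]. now constructor. }
      destruct Fx as [|x a Fx Wx]; [lia|].
      rewrite HW in Wx. apply andb_true_iff in Wx as [_ Wx]. apply Nat.leb_le in Wx.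
      assert (E : (1 <= length (filter F (parents (x ++ [a]))))%nat).
      { assert (I : In x (filter F (parents (x ++ [a])))).
        { apply filter_In. split; [apply in_parents; eauto|now apply HF]. }
        destruct (filter F (parents (x ++ [a]))); [destruct I|simpl; lia]. }
      lia.
  - intros Hb F HF [x0 Hx0]. apply NNPP. intros Hno.
    assert (Hforb : forall x, F x = true -> (eta x < length (filter F (nbrs d x)))%nat).
    { intros x Fx. apply Nat.nle_gt. intros L. apply Hno. eauto. }
    assert (HFW : forall x, F x = true -> W x = true).
    { destruct (exists_length_bound V) as [L HL].
      assert (K : forall n x, (L - length x <= n)%nat -> F x = true -> W x = true).
      { induction n as [|n IH]; intros x Hn Fx.
        - specialize (HL x (HF x Fx)). lia.
        - rewrite HW. apply andb_true_iff. split; [apply inVb_iff; auto|].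
          apply Nat.leb_le. specialize (Hforb x Fx).
          unfold nbrs in Hforb. rewrite filter_app, length_app in Hforb.
          assert (Lc : (length (filter F (children d x)) <= length (filter W (children d x)))%nat).
          { apply filter_length_mono. intros y Hy Fy. apply IH; [|assumption].
            specialize (HL y (HF y Fy)). apply in_children in Hy as [a [-> _]].
            rewrite length_app in *. simpl in *. lia. }
          assert (Lp := filter_length_le F (parents x)).
          assert (length (parents x) <= 1)%nat by (destruct x; simpl; lia). lia. }
      intros x. now apply (K (L - length x)%nat). }
    assert (Hmin : exists x, F x = true /\ forall y, F y = true -> (length x <= length y)%nat).
    { assert (K : forall n x, (length x <= n)%nat -> F x = true ->
         exists x, F x = true /\ forall y, F y = true -> (length x <= length y)%nat).
      { induction n as [|n IH]; intros x Hn Fx; [exists x; split; [auto|intros; lia]|].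
        destruct (classic (exists y, F y = true /\ (length y < length x)%nat)) as [[y [Fy Hy]]|N].
        - apply (IH y); [lia|assumption].
        - exists x. split; [assumption|]. intros y Fy. apply Nat.nlt_ge. intros L. apply N. eauto. }
      now apply (K (length x0) x0). }
    destruct Hmin as [x [Fx Hm]]. specialize (Hforb x Fx).
    unfold nbrs in Hforb. rewrite filter_app, length_app in Hforb.
    assert (Ep : filter F (parents x) = []).
    { destruct x as [|b x]; [reflexivity|]. change (parents (b :: x)) with [removelast (b :: x)].
      cbn [filter]. destruct (F (removelast (b :: x))) eqn:E; [|reflexivity]. exfalso.
      apply Hm in E.
      assert (Ex : b :: x = removelast (b :: x) ++ [last (b :: x) 0%nat])
        by (apply app_removelast_last; discriminate).
      apply (f_equal (@length nat)) in Ex. rewrite length_app in Ex. simpl in *. lia. }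
    rewrite Ep in Hforb. simpl in Hforb.
    assert (Lc : (length (filter F (children d x)) <= length (filter W (children d x)))%nat)
      by (apply filter_length_mono; auto).
    specialize (Hb x (HF x Fx)). lia.
Qed.

(** The depth left at [x] is [K - length x], which turns the depth-indexed [weakb] into one
    predicate [W]; as [K] exceeds the length of every vertex of [V], the recursion does not stop too
    early. *)
Lemma okb_root_iff (d : nat) (V : list vertex) (cst : vertex -> nat -> bool) (eta : vertex -> nat)
  (K : nat) : within d V -> (forall w, In w V -> (length w < K)%nat) ->
  (okb d (inVb V) cst eta K [] = true <->
   allowed d V eta /\ forall w, In w V -> cst w (eta w) = true).
Proof.
  intros HV HK. set (W := fun x => weakb d (inVb V) eta (K - length x) x).
  assert (Hch : forall x k, (K - length x = S k)%nat ->
    filter (weakb d (inVb V) eta k) (children d x) = filter W (children d x)).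
  { intros x k Hk. apply filter_ext_in. intros y Hy. unfold W. f_equal.
    apply in_children in Hy as [a [-> _]]. rewrite length_app. simpl. lia. }
  assert (HW : forall x, W x = inVb V x && Nat.leb (eta x) (length (filter W (children d x)))).
  { intros x. unfold W at 1. destruct (K - length x)%nat as [|k] eqn:E.
    - simpl. destruct (inVb V x) eqn:Ex; [|reflexivity].
      apply inVb_iff in Ex. specialize (HK x Ex). lia.
    - simpl weakb. now rewrite (Hch x k E). }
  rewrite (allowed_iff_weak_bound d V eta W HV HW), okb_iff by exact I. split.
  - intros H. split; intros c Hc; destruct (H c) as [H1 H2]; simpl; auto; try (now apply inVb_iff).
    rewrite <- (Hch c (K - S (length c))%nat); [exact H2|]. specialize (HK c Hc). lia.
  - intros [H1 H2] s Hs Hr HP. simpl in *. apply inVb_iff in HP. split; [auto|].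
    rewrite (Hch s) by lia. auto.
Qed.

(** * Counting configurations on branches *)

Definition Rsum {A : Type} (l : list A) (f : A -> R) : R := fold_right (fun a s => f a + s) 0 l.
Definition Rprod {A : Type} (l : list A) (f : A -> R) : R := fold_right (fun a s => f a * s) 1 l.

Lemma Rsum_ext (A : Type) (l : list A) (f g : A -> R) :
  (forall x, In x l -> f x = g x) -> Rsum l f = Rsum l g.
Proof.
  induction l as [|x l IH]; intros H; [reflexivity|]. simpl.
  rewrite (H x) by now left. rewrite IH; [reflexivity|]. intros; apply H; now right.
Qed.

Lemma Rsum_app (A : Type) (l1 l2 : list A) (f : A -> R) : Rsum (l1 ++ l2) f = Rsum l1 f + Rsum l2 f.
Proof. induction l1 as [|x l IH]; simpl; [|rewrite IH]; ring. Qed.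

Lemma Rsum_plus (A : Type) (l : list A) (f g : A -> R) :
  Rsum l (fun x => f x + g x) = Rsum l f + Rsum l g.
Proof. induction l as [|x l IH]; simpl; [|rewrite IH]; ring. Qed.

Lemma Rsum_scal (A : Type) (l : list A) (a : R) (f : A -> R) :
  Rsum l (fun x => a * f x) = a * Rsum l f.
Proof. induction l as [|x l IH]; simpl; [|rewrite IH]; ring. Qed.

Lemma Rsum_const (A : Type) (l : list A) (a : R) : Rsum l (fun _ => a) = INR (length l) * a.
Proof.
  induction l as [|x l IH]; [simpl; ring|]. simpl Rsum. rewrite IH.
  change (length (x :: l)) with (S (length l)). rewrite S_INR. ring.
Qed.

Lemma Rsum_le (A : Type) (l : list A) (f g : A -> R) :
  (forall x, In x l -> f x <= g x) -> Rsum l f <= Rsum l g.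
Proof.
  induction l as [|x l IH]; intros H; [simpl; lra|]. simpl.
  assert (H1 := H x (or_introl eq_refl)). assert (H2 := IH (fun y h => H y (or_intror h))). lra.
Qed.

Lemma Rprod_pos (A : Type) (l : list A) (f : A -> R) :
  (forall x, In x l -> 0 < f x) -> 0 < Rprod l f.
Proof.
  induction l as [|x l IH]; intros H; simpl; [lra|].
  apply Rmult_lt_0_compat; [apply H; now left|apply IH; intros; apply H; now right].
Qed.

Definition upd (eta : vertex -> nat) (w : vertex) (h : nat) : vertex -> nat :=
  fun v => if leqb v w then h else eta v.

Lemma upd_same (eta : vertex -> nat) (w : vertex) (h : nat) : upd eta w h w = h.
Proof. unfold upd. now rewrite leqb_refl. Qed.

Lemma upd_other (eta : vertex -> nat) (w v : vertex) (h : nat) : v <> w -> upd eta w h v = eta v.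
Proof. intros H. unfold upd. now rewrite leqb_neq. Qed.

Fixpoint confs (d : nat) (l : list vertex) (eta0 : vertex -> nat) : list (vertex -> nat) :=
  match l with
  | [] => [eta0]
  | w :: l => flat_map (fun h => confs d l (upd eta0 w h)) (seq 0 d)
  end.

Lemma in_confs (d : nat) (l : list vertex) (eta0 eta : vertex -> nat) : NoDup l ->
  (In eta (confs d l eta0) <->
   (forall w, In w l -> (eta w < d)%nat) /\ (forall w, ~ In w l -> eta w = eta0 w)).
Proof.
  intros ND. revert eta0. induction ND as [|v l Hv ND IH]; intros eta0; simpl.
  - split.
    + intros [->|[]]. split; [intros ? []|reflexivity].
    + intros [_ H]. left. apply functional_extensionality. intros w. symmetry. now apply H.
  - rewrite in_flat_map. split.
    + intros [h [Hh H]]. apply in_seq in Hh. apply IH in H as [H1 H2]. split.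
      * intros w [<-|Hw]; [|auto]. rewrite H2, upd_same by assumption. lia.
      * intros w Hw. rewrite H2 by tauto. apply upd_other. intros ->. tauto.
    + intros [H1 H2]. exists (eta v). split.
      * apply in_seq. specialize (H1 v (or_introl eq_refl)). lia.
      * apply IH. split; [auto|]. intros w Hw.
        destruct (list_eq_dec Nat.eq_dec w v) as [->|Hwv].
        -- now rewrite upd_same.
        -- rewrite upd_other by assumption. apply H2. intuition.
Qed.

Lemma NoDup_confs (d : nat) (l : list vertex) (eta0 : vertex -> nat) : NoDup l -> NoDup (confs d l eta0).
Proof.
  intros ND. revert eta0. induction ND as [|v l Hv ND IH]; intros eta0; simpl.
  - repeat constructor. intros [].
  - assert (K : forall hs, NoDup hs -> NoDup (flat_map (fun h => confs d l (upd eta0 v h)) hs)).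
    { induction 1 as [|h hs Hh NDh IHh]; [constructor|]. simpl. apply NoDup_app; auto.
      intros eta H1 H2. apply in_flat_map in H2 as [h' [Hh' H2]].
      apply in_confs in H1 as [_ H1]; [|assumption]. apply in_confs in H2 as [_ H2]; [|assumption].
      specialize (H1 v Hv). specialize (H2 v Hv). rewrite upd_same in *. congruence. }
    apply K, seq_NoDup.
Qed.

(** The argument [eta0] holds the values already chosen, so that a sum over a concatenation is an
    iterated sum. *)
Definition csum (d : nat) (l : list vertex) (eta0 : vertex -> nat) (F : (vertex -> nat) -> R) : R :=
  Rsum (confs d l eta0) F.

Lemma Rsum_flat_map (A B : Type) (l : list A) (g : A -> list B) (f : B -> R) :
  Rsum (flat_map g l) f = Rsum l (fun x => Rsum (g x) f).
Proof. induction l as [|x l IH]; [reflexivity|]. simpl. now rewrite Rsum_app, IH. Qed.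

Lemma csum_cons (d : nat) (w : vertex) (l : list vertex) (eta0 : vertex -> nat) (F : (vertex -> nat) -> R) :
  csum d (w :: l) eta0 F = Rsum (seq 0 d) (fun h => csum d l (upd eta0 w h) F).
Proof. unfold csum. simpl. apply Rsum_flat_map. Qed.

Lemma csum_app (d : nat) (l1 l2 : list vertex) (eta0 : vertex -> nat) (F : (vertex -> nat) -> R) :
  csum d (l1 ++ l2) eta0 F = csum d l1 eta0 (fun eta => csum d l2 eta F).
Proof.
  revert eta0. induction l1 as [|w l1 IH]; intros eta0.
  - unfold csum at 2. simpl. ring.
  - simpl app. rewrite !csum_cons. apply Rsum_ext. auto.
Qed.

Lemma csum_ext (d : nat) (l : list vertex) (eta0 : vertex -> nat) (F G : (vertex -> nat) -> R) :
  (forall eta, (forall w, ~ In w l -> eta w = eta0 w) -> F eta = G eta) ->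
  csum d l eta0 F = csum d l eta0 G.
Proof.
  revert eta0. induction l as [|v l IH]; intros eta0 H.
  - unfold csum. simpl. now rewrite H.
  - rewrite !csum_cons. apply Rsum_ext. intros h _. apply IH. intros eta He. apply H.
    intros w Hw. rewrite He by (intros ?; apply Hw; now right).
    apply upd_other. intros ->. apply Hw. now left.
Qed.

Lemma Rsum_indicator (A : Type) (l : list A) (f : A -> bool) :
  Rsum l (fun x => if f x then 1 else 0) = INR (length (filter f l)).
Proof.
  induction l as [|x l IH]; [reflexivity|]. simpl Rsum. simpl filter. rewrite IH.
  destruct (f x); [|ring].
  change (length (x :: filter f l)) with (S (length (filter f l))). rewrite S_INR. ring.
Qed.

Fixpoint tv (d : nat) (P : vertex -> bool) (k : nat) (c : vertex) : list vertex :=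
  match k with
  | O => []
  | S k => (if P c then [c] else []) ++ flat_map (tv d P k) (children d c)
  end.

Lemma in_tv (d : nat) (P : vertex -> bool) (k : nat) (c x : vertex) : reduced d c ->
  (In x (tv d P k c) <-> exists s, x = c ++ s /\ (length s < k)%nat /\ reduced d x /\ P x = true).
Proof.
  revert c. induction k as [|k IH]; intros c Hc; simpl tv.
  - split; [intros []|]. intros [s [_ [Hs _]]]. lia.
  - rewrite in_app_iff, in_flat_map. split.
    + intros [H|[y [Hy H]]].
      * destruct (P c) eqn:E; [|destruct H]. destruct H as [<-|[]].
        exists []. rewrite app_nil_r. simpl. repeat split; auto; lia.
      * assert (Hyr := children_reduced d c y Hc Hy).
        apply IH in H as [s [-> [Hs H]]]; [|assumption].
        apply in_children in Hy as [a [-> _]]. exists (a :: s). rewrite <- app_assoc in *.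
        simpl in *. repeat split; try tauto; lia.
    + intros [[|a s] [-> [Hs [Hr HP]]]].
      * left. rewrite app_nil_r in *. rewrite HP. now left.
      * right. replace (c ++ a :: s) with ((c ++ [a]) ++ s) in * by (rewrite <- app_assoc; reflexivity).
        assert (Hca : reduced d (c ++ [a])) by now apply reduced_prefix in Hr.
        exists (c ++ [a]). split.
        -- apply in_children. exists a. apply reduced_snoc in Hca. tauto.
        -- apply IH; [assumption|]. exists s. simpl in Hs. repeat split; auto. lia.
Qed.

Lemma tv_disjoint (d : nat) (P : vertex -> bool) (k : nat) (c y z x : vertex) : reduced d c ->
  In y (children d c) -> In z (children d c) -> In x (tv d P k y) -> In x (tv d P k z) -> y = z.
Proof.
  intros Hc Hy Hz H1 H2.
  apply in_tv in H1 as [s [E1 _]]; [|eapply children_reduced; eauto].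
  apply in_tv in H2 as [t [E2 _]]; [|eapply children_reduced; eauto].
  apply in_children in Hy as [a [-> _]]. apply in_children in Hz as [b [-> _]].
  subst x. rewrite <- !app_assoc in E2. apply app_inv_head in E2. simpl in E2. congruence.
Qed.

Lemma root_notin_tvs (d : nat) (P : vertex -> bool) (k : nat) (c : vertex) : reduced d c ->
  ~ In c (flat_map (tv d P k) (children d c)).
Proof.
  intros Hc H. apply in_flat_map in H as [y [Hy H]].
  apply in_tv in H as [s [E _]]; [|eapply children_reduced; eauto].
  apply in_children in Hy as [a [-> _]].
  apply (f_equal (@length nat)) in E. rewrite !length_app in E. simpl in E. lia.
Qed.

Lemma NoDup_tv (d : nat) (P : vertex -> bool) (k : nat) (c : vertex) : reduced d c -> NoDup (tv d P k c).
Proof.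
  revert c. induction k as [|k IH]; intros c Hc; simpl; [constructor|].
  apply NoDup_app.
  - destruct (P c); repeat constructor. intros [].
  - assert (K : forall js, NoDup js -> incl js (children d c) -> NoDup (flat_map (tv d P k) js)).
    { induction 1 as [|y js Hy ND IHj]; intros Hi; simpl; [constructor|].
      assert (Hyc : In y (children d c)) by (apply Hi; now left).
      apply NoDup_app.
      - apply IH. eapply children_reduced; eauto.
      - apply IHj. intros z Hz. apply Hi. now right.
      - intros x H1 H2. apply in_flat_map in H2 as [z [Hz H2]]. apply Hy.
        replace y with z; [assumption|].
        apply (tv_disjoint d P k c z y x); auto. apply Hi. now right. }
    apply K; [apply NoDup_children|apply incl_refl].
  - intros x H1 H2. destruct (P c); [|destruct H1]. destruct H1 as [<-|[]].
    now apply root_notin_tvs in H2.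
Qed.

Lemma forallb_ext_in (A : Type) (f g : A -> bool) (l : list A) :
  (forall x, In x l -> f x = g x) -> forallb f l = forallb g l.
Proof.
  induction l as [|x l IH]; intros H; [reflexivity|]. simpl.
  rewrite (H x) by now left. f_equal. apply IH. intros; apply H; now right.
Qed.

(** Both predicates look only at the branch of [c]; this is what makes sums over sibling branches
    factor. *)
Lemma weakb_ok_local (d : nat) (P : vertex -> bool) (cst : vertex -> nat -> bool) (k : nat)
  (c : vertex) (eta zeta : vertex -> nat) :
  (forall w, In w (tv d P k c) -> eta w = zeta w) ->
  weakb d P eta k c = weakb d P zeta k c /\ okb d P cst eta k c = okb d P cst zeta k c.
Proof.
  revert c. induction k as [|k IH]; intros c H; [split; reflexivity|]. simpl.
  assert (Hch : forall j, In j (children d c) ->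
    weakb d P eta k j = weakb d P zeta k j /\ okb d P cst eta k j = okb d P cst zeta k j).
  { intros j Hj. apply IH. intros w Hw. apply H. simpl. apply in_or_app. right.
    apply in_flat_map. eauto. }
  rewrite (filter_ext_in (weakb d P eta k) (weakb d P zeta k)) by (intros; now apply Hch).
  rewrite (forallb_ext_in _ (okb d P cst eta k) (okb d P cst zeta k)) by (intros; now apply Hch).
  destruct (P c) eqn:E; [|split; reflexivity].
  rewrite (H c); [split; reflexivity|]. simpl. rewrite E. now left.
Qed.

(* Expectation of [g] of the number of weak children, child [j] having weight [f j true] of
   being weak and [f j false] of not being weak, independently. *)
Fixpoint wexp (f : vertex -> bool -> R) (js : list vertex) (g : nat -> R) : R :=
  match js with
  | [] => g 0%nat
  | j :: js => f j false * wexp f js g + f j true * wexp f js (fun m => g (S m))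
  end.

Lemma wexp_ext (f : vertex -> bool -> R) (js : list vertex) (g g' : nat -> R) :
  (forall m, (m <= length js)%nat -> g m = g' m) -> wexp f js g = wexp f js g'.
Proof.
  revert g g'. induction js as [|j js IH]; intros g g' H; simpl; [apply H; simpl; lia|].
  rewrite (IH g g') by (intros; apply H; simpl; lia).
  rewrite (IH (fun m => g (S m)) (fun m => g' (S m))) by (intros; apply H; simpl; lia). ring.
Qed.

Lemma wexp_ext_weight (f f' : vertex -> bool -> R) (js : list vertex) (g : nat -> R) :
  (forall j b, In j js -> f j b = f' j b) -> wexp f js g = wexp f' js g.
Proof.
  revert g. induction js as [|j js IH]; intros g H; simpl; [reflexivity|].
  rewrite !(H j) by now left. now rewrite !IH by (intros; apply H; now right).
Qed.

Lemma wexp_plus (f : vertex -> bool -> R) (js : list vertex) (g g' : nat -> R) :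
  wexp f js (fun m => g m + g' m) = wexp f js g + wexp f js g'.
Proof.
  revert g g'. induction js as [|j js IH]; intros g g'; simpl; [reflexivity|].
  rewrite IH, (IH (fun m => g (S m))). ring.
Qed.

Lemma wexp_scal (f : vertex -> bool -> R) (js : list vertex) (a : R) (g : nat -> R) :
  wexp f js (fun m => a * g m) = a * wexp f js g.
Proof.
  revert g. induction js as [|j js IH]; intros g; simpl; [reflexivity|].
  rewrite IH, (IH (fun m => g (S m))). ring.
Qed.

Lemma wexp_sum (f : vertex -> bool -> R) (js : list vertex) (hs : list nat) (g : nat -> nat -> R) :
  Rsum hs (fun h => wexp f js (g h)) = wexp f js (fun m => Rsum hs (fun h => g h m)).
Proof.
  induction hs as [|h hs IH]; simpl.
  - rewrite (wexp_ext f js (fun _ => 0) (fun m => 0 * 0)) by (intros; ring).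
    rewrite wexp_scal. ring.
  - now rewrite wexp_plus, IH.
Qed.

(** Here [h] is the height of [c] and [m] the number of its weak children. Given [m <= h], the
    vertex is weak exactly when [h = m], and [g] is told which case occurs. *)
Definition vweight (d : nat) (cst : vertex -> nat -> bool) (f : vertex -> bool -> R) (c : vertex)
  (g : bool -> R) : R :=
  Rsum (seq 0 d) (fun h => wexp f (children d c)
    (fun m => if cst c h && Nat.leb m h then g (Nat.leb h m) else 0)).

(* For the branch at [c], given that the parent of [c] burns: [znorm] is the number of recurrent
   configurations, [pstrong] the fraction of them in which [c] is not weak, and [nweight b] the
   fraction satisfying the constraint [cst] in which [c] is weak ([b = true]) or not. *)
Fixpoint pstrong (d : nat) (P : vertex -> bool) (k : nat) (c : vertex) : R :=
  match k with
  | O => 1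
  | S k => if P c then let s := Rsum (children d c) (pstrong d P k) in s / (1 + s) else 1
  end.

Fixpoint znorm (d : nat) (P : vertex -> bool) (k : nat) (c : vertex) : R :=
  match k with
  | O => 1
  | S k => Rprod (children d c) (znorm d P k) *
           (if P c then 1 + Rsum (children d c) (pstrong d P k) else 1)
  end.

Fixpoint nweight (d : nat) (P : vertex -> bool) (cst : vertex -> nat -> bool) (k : nat) (c : vertex)
  (b : bool) : R :=
  match k with
  | O => if b then 0 else 1
  | S k => if P c
      then vweight d cst (nweight d P cst k) c (fun b' => if eqb b' b then 1 else 0)
           / (1 + Rsum (children d c) (pstrong d P k))
      else wexp (nweight d P cst k) (children d c) (fun _ => if b then 0 else 1)
  end.

Lemma pstrong_bounds (d : nat) (P : vertex -> bool) (k : nat) (c : vertex) :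
  0 <= pstrong d P k c <= 1.
Proof.
  revert c. induction k as [|k IH]; intros c; simpl; [lra|].
  destruct (P c); [|lra].
  assert (H : 0 <= Rsum (children d c) (pstrong d P k)).
  { rewrite <- (Rmult_0_r (INR (length (children d c)))), <- Rsum_const.
    apply Rsum_le. intros; apply IH. }
  set (s := Rsum _ _) in *. split.
  - apply Rmult_le_pos; [assumption|]. left. apply Rinv_0_lt_compat. lra.
  - apply Rmult_le_reg_r with (1 + s); [lra|]. field_simplify; lra.
Qed.

Lemma sum_pstrong_nonneg (d : nat) (P : vertex -> bool) (k : nat) (js : list vertex) :
  0 <= Rsum js (pstrong d P k).
Proof.
  rewrite <- (Rmult_0_r (INR (length js))), <- Rsum_const.
  apply Rsum_le. intros; apply pstrong_bounds.
Qed.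

Lemma znorm_pos (d : nat) (P : vertex -> bool) (k : nat) (c : vertex) : 0 < znorm d P k c.
Proof.
  revert c. induction k as [|k IH]; intros c; simpl; [lra|].
  apply Rmult_lt_0_compat; [apply Rprod_pos; auto|].
  assert (H := sum_pstrong_nonneg d P k (children d c)). destruct (P c); lra.
Qed.

Lemma vweight_split (d : nat) (cst : vertex -> nat -> bool) (f : vertex -> bool -> R) (c : vertex)
  (g : bool -> R) :
  vweight d cst f c g = g false * vweight d cst f c (fun b => if eqb b false then 1 else 0)
                      + g true * vweight d cst f c (fun b => if eqb b true then 1 else 0).
Proof.
  unfold vweight. rewrite <- !Rsum_scal, <- Rsum_plus. apply Rsum_ext. intros h _.
  rewrite <- !wexp_scal, <- wexp_plus. apply wexp_ext. intros m _.
  destruct (cst c h && Nat.leb m h), (Nat.leb h m); simpl; ring.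
Qed.

(** The hypothesis on single branches is the induction hypothesis of [csum_branch]. It is needed for
    all [eta0] and [g]: the siblings not yet summed enter through [g], which is shifted by one after
    a weak child. *)
Lemma csum_siblings (d : nat) (P : vertex -> bool) (cst : vertex -> nat -> bool) (k : nat)
  (c : vertex) (js : list vertex) (eta0 : vertex -> nat) (g : nat -> R) : reduced d c ->
  (forall j eta0 g, In j (children d c) ->
    csum d (tv d P k j) eta0 (fun eta => if okb d P cst eta k j then g (weakb d P eta k j) else 0) =
    znorm d P k j * (nweight d P cst k j false * g false + nweight d P cst k j true * g true)) ->
  NoDup js -> incl js (children d c) ->
  csum d (flat_map (tv d P k) js) eta0
    (fun eta => if forallb (okb d P cst eta k) js
                then g (length (filter (weakb d P eta k) js)) else 0) =
  Rprod js (znorm d P k) * wexp (nweight d P cst k) js g.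
Proof.
  intros Hc Hv ND. revert eta0 g. induction ND as [|j js Hj ND IH]; intros eta0 g Hi.
  - unfold csum. simpl. ring.
  - assert (Hjc : In j (children d c)) by (apply Hi; now left).
    assert (Hi' : incl js (children d c)) by (intros z Hz; apply Hi; now right).
    simpl flat_map. rewrite csum_app.
    (* [G b] is the value of the sum over the remaining siblings once it is known whether [j] is
       weak. *)
    set (G := fun b : bool => Rprod js (znorm d P k) *
      wexp (nweight d P cst k) js (if b then fun m => g (S m) else g)).
    rewrite (csum_ext d (tv d P k j) eta0 _
      (fun eta => if okb d P cst eta k j then G (weakb d P eta k j) else 0)).
    + rewrite Hv by assumption. unfold G. simpl. ring.
    + intros eta1 _.
      rewrite (csum_ext _ _ _ _ (fun eta => if okb d P cst eta1 k j then
         (if forallb (okb d P cst eta k) js then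
            (if weakb d P eta1 k j then fun m => g (S m) else g)
              (length (filter (weakb d P eta k) js)) else 0) else 0)).
      * destruct (okb d P cst eta1 k j).
        -- unfold G. now rewrite IH.
        -- unfold csum. rewrite Rsum_const. ring.
      * intros eta He. simpl.
        destruct (weakb_ok_local d P cst k j eta eta1) as [E1 E2].
        { intros w Hw. apply He. intros Hw'. apply in_flat_map in Hw' as [z [Hz Hw']].
          apply Hj. replace j with z; [assumption|].
          apply (tv_disjoint d P k c z j w); auto. }
        rewrite E1, E2. destruct (okb d P cst eta1 k j); [|reflexivity]. simpl.
        destruct (forallb (okb d P cst eta k) js), (weakb d P eta1 k j); reflexivity.
Qed.

(** Kept apart from [csum_branch] because it serves the root too, which has [d] children and a
    different normalization. *)
Lemma csum_vertex (d : nat) (P : vertex -> bool) (cst : vertex -> nat -> bool) (k : nat)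
  (c : vertex) (eta0 : vertex -> nat) (g : bool -> R) : reduced d c -> P c = true ->
  (forall j eta0 g, In j (children d c) ->
    csum d (tv d P k j) eta0 (fun eta => if okb d P cst eta k j then g (weakb d P eta k j) else 0) =
    znorm d P k j * (nweight d P cst k j false * g false + nweight d P cst k j true * g true)) ->
  csum d (tv d P (S k) c) eta0
    (fun eta => if okb d P cst eta (S k) c then g (weakb d P eta (S k) c) else 0) =
  Rprod (children d c) (znorm d P k) * vweight d cst (nweight d P cst k) c g.
Proof.
  intros Hc HP Hv. simpl tv. rewrite HP. simpl app. rewrite csum_cons.
  unfold vweight. rewrite <- Rsum_scal. apply Rsum_ext. intros h _.
  rewrite <- (csum_siblings d P cst k c (children d c) (upd eta0 c h)); auto;
    [|apply NoDup_children|apply incl_refl].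
  apply csum_ext. intros eta He. simpl. rewrite HP.
  rewrite (He c), upd_same by now apply root_notin_tvs.
  destruct (forallb _ _); [|reflexivity]. simpl.
  destruct (cst c h && _); reflexivity.
Qed.

(** A branch influences the rest of the tree only through whether its top vertex is weak, hence the
    arbitrary [g]. *)
Lemma csum_branch (d : nat) (P : vertex -> bool) (cst : vertex -> nat -> bool) (k : nat)
  (c : vertex) (eta0 : vertex -> nat) (g : bool -> R) : reduced d c ->
  csum d (tv d P k c) eta0 (fun eta => if okb d P cst eta k c then g (weakb d P eta k c) else 0) =
  znorm d P k c * (nweight d P cst k c false * g false + nweight d P cst k c true * g true).
Proof.
  revert c eta0 g. induction k as [|k IH]; intros c eta0 g Hc.
  - unfold csum. simpl. ring.
  - assert (Hv : forall j eta0 g, In j (children d c) ->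
      csum d (tv d P k j) eta0 (fun eta => if okb d P cst eta k j then g (weakb d P eta k j) else 0) =
      znorm d P k j * (nweight d P cst k j false * g false + nweight d P cst k j true * g true)).
    { intros j e g' Hj. apply IH. eapply children_reduced; eauto. }
    destruct (P c) eqn:HP.
    + rewrite csum_vertex by auto. simpl. rewrite HP, (vweight_split _ _ _ _ g).
      assert (H := sum_pstrong_nonneg d P k (children d c)). field. lra.
    (* A vertex outside [P] has no height to sum over and is never weak; only the branches of its
       children remain. *)
    + simpl tv. rewrite HP. simpl app.
      rewrite (csum_ext _ _ _ _ (fun eta => if forallb (okb d P cst eta k) (children d c)
         then (fun _ => g false) (length (filter (weakb d P eta k) (children d c))) else 0)).
      * etransitivity; [apply (csum_siblings d P cst k c) with (g := fun _ => g false); auto|].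
        { apply NoDup_children. }
        { apply incl_refl. }
        simpl. rewrite HP.
        rewrite (wexp_ext _ _ (fun _ => g false) (fun _ => g false * 1)) by (intros; ring).
        rewrite (wexp_ext _ _ (fun _ => 0) (fun _ => 0 * 1)) by (intros; ring).
        rewrite !wexp_scal. ring.
      * intros eta _. simpl. rewrite HP. simpl. now rewrite andb_true_r.
Qed.

(** * Convergence of cylinder probabilities *)

Definition free (w : vertex) (h : nat) : bool := true.

Lemma count_ge (m d : nat) : (m <= d)%nat ->
  Rsum (seq 0 d) (fun h => if Nat.leb m h then 1 else 0) = INR d - INR m.
Proof.
  induction d as [|d IH]; intros H.
  - assert (m = 0)%nat by lia. subst. simpl. ring.
  - rewrite seq_S, Rsum_app. simpl Nat.add. cbn [Rsum fold_right].
    destruct (Nat.eq_dec m (S d)) as [->|Hm].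
    + rewrite (Rsum_ext _ _ _ (fun _ => 0)), Rsum_const.
      * rewrite (proj2 (Nat.leb_gt (S d) d)) by lia. ring.
      * intros h Hh. apply in_seq in Hh. now rewrite (proj2 (Nat.leb_gt (S d) h)) by lia.
    + rewrite IH by lia. rewrite (proj2 (Nat.leb_le m d)) by lia. rewrite S_INR. ring.
Qed.

Lemma count_eq (m d : nat) : (m < d)%nat ->
  Rsum (seq 0 d) (fun h => if Nat.leb m h then (if Nat.leb h m then 1 else 0) else 0) = 1.
Proof.
  intros H.
  rewrite (Rsum_ext _ _ _ (fun h => (if Nat.leb m h then 1 else 0) + -1 * (if Nat.leb (S m) h then 1 else 0))).
  - rewrite Rsum_plus, Rsum_scal, !count_ge by lia. rewrite S_INR. ring.
  - intros h _. destruct (Nat.leb_spec m h), (Nat.leb_spec h m), (Nat.leb_spec (S m) h); try lia; ring.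
Qed.

(** Linearity of expectation for the number of weak children. *)
Lemma wexp_linear (f : vertex -> bool -> R) (js : list vertex) (a : R) :
  (forall j, In j js -> f j false + f j true = 1) ->
  wexp f js (fun m => a - INR m) = a - INR (length js) + Rsum js (fun j => f j false).
Proof.
  revert a. induction js as [|j js IH]; intros a H.
  - simpl. ring.
  - cbn [wexp].
    rewrite (wexp_ext f js (fun m => a - INR (S m)) (fun m => (a - 1) - INR m))
      by (intros; rewrite S_INR; ring).
    rewrite !IH by (intros; apply H; now right).
    specialize (H j (or_introl eq_refl)).
    change (length (j :: js)) with (S (length js)). rewrite S_INR. cbn [Rsum fold_right].
    fold (Rsum js (fun j => f j false)).
    replace (f j true) with (1 - f j false) by lra. ring.
Qed.

Lemma wexp_one (f : vertex -> bool -> R) (js : list vertex) :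
  (forall j, In j js -> f j false + f j true = 1) -> wexp f js (fun _ => 1) = 1.
Proof.
  induction js as [|j js IH]; intros H; [reflexivity|]. cbn [wexp].
  rewrite IH by (intros; apply H; now right). specialize (H j (or_introl eq_refl)). lra.
Qed.

Lemma vweight_free (d : nat) (f : vertex -> bool -> R) (c : vertex) (g : bool -> R) :
  vweight d free f c g =
  wexp f (children d c) (fun m => Rsum (seq 0 d)
    (fun h => if Nat.leb m h then g (Nat.leb h m) else 0)).
Proof. unfold vweight. rewrite wexp_sum. reflexivity. Qed.

(** The source of [s / (1 + s)]: with [m] weak children the heights [m, ..., d - 1] are admissible.
    One of them makes [c] weak, and the other [d - 1 - m] are as many as the strong children, whose
    mean number is [s]. *)
Lemma nweight_free (d : nat) (P : vertex -> bool) (k : nat) (c : vertex) : (1 <= d)%nat ->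
  reduced d c -> c <> [] ->
  nweight d P free k c false = pstrong d P k c /\ nweight d P free k c true = 1 - pstrong d P k c.
Proof.
  intros Hd. revert c. induction k as [|k IH]; intros c Hc Hn; [simpl; split; ring|]. simpl.
  assert (Hj : forall j, In j (children d c) -> reduced d j /\ j <> []).
  { intros j Hj. split; [eapply children_reduced; eauto|].
    apply in_children in Hj as [a [-> _]]. now destruct c. }
  assert (H1 : forall j, In j (children d c) ->
     nweight d P free k j false + nweight d P free k j true = 1).
  { intros j Hj'. apply Hj in Hj' as [H1 H2]. destruct (IH j H1 H2) as [-> ->]. ring. }
  assert (Hl := length_children d c Hc Hn).
  destruct (P c).
  - assert (Hs := sum_pstrong_nonneg d P k (children d c)).
    rewrite !vweight_free.
    rewrite (wexp_ext _ _ _ (fun m => (INR d - 1) - INR m)).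
    2:{ intros m Hm.
        rewrite (Rsum_ext _ _ _ (fun h => if Nat.leb (S m) h then 1 else 0)).
        - rewrite count_ge by lia. rewrite S_INR. ring.
        - intros h _. destruct (Nat.leb_spec m h), (Nat.leb_spec h m), (Nat.leb_spec (S m) h);
            simpl; try lia; reflexivity. }
    rewrite (wexp_ext _ _ (fun m => Rsum _ _) (fun m => 1)).
    2:{ intros m Hm. etransitivity; [|apply (count_eq m d); lia]. apply Rsum_ext. intros h _.
        now destruct (Nat.leb m h), (Nat.leb h m). }
    rewrite wexp_one, wexp_linear by assumption. rewrite Hl, minus_INR by assumption.
    rewrite (Rsum_ext _ (children d c) (fun j => nweight d P free k j false) (pstrong d P k))
      by (intros j Hj'; apply Hj in Hj' as [? ?]; now apply IH).
    simpl (INR 1). split; field; lra.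
  - rewrite wexp_one by assumption.
    rewrite (wexp_ext _ _ (fun _ => 0) (fun _ => 0 * 1)), wexp_scal by (intros; ring).
    split; ring.
Qed.

(** Used to replace the constraint by [free] on branches that it does not touch. *)
Lemma nweight_ext (d : nat) (P : vertex -> bool) (cst cst' : vertex -> nat -> bool) (k : nat)
  (c : vertex) (b : bool) : (forall s h, cst (c ++ s) h = cst' (c ++ s) h) ->
  nweight d P cst k c b = nweight d P cst' k c b.
Proof.
  revert c b. induction k as [|k IH]; intros c b H; [reflexivity|]. simpl.
  assert (Hj : forall j b, In j (children d c) -> nweight d P cst k j b = nweight d P cst' k j b).
  { intros j b' Hj. apply IH. apply in_children in Hj as [a [-> _]].
    intros s h. rewrite <- app_assoc. apply H. }
  destruct (P c).
  - unfold Rdiv. f_equal. unfold vweight. apply Rsum_ext. intros h _.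
    rewrite (wexp_ext_weight _ (nweight d P cst' k)) by assumption.
    apply wexp_ext. intros m _. specialize (H [] h). rewrite app_nil_r in H. now rewrite H.
  - now apply wexp_ext_weight.
Qed.

(** The positive fixed point of [p = (d - 1) p / (1 + (d - 1) p)]. *)
Definition pstar (d : nat) : R := (INR d - 2) / (INR d - 1).

Lemma INR_ge_3 (d : nat) : (3 <= d)%nat -> 3 <= INR d.
Proof. intros H. apply le_INR in H. simpl in H. lra. Qed.

Lemma pstar_bounds (d : nat) : (3 <= d)%nat -> 0 < pstar d < 1.
Proof.
  intros H. apply INR_ge_3 in H. unfold pstar. split.
  - apply Rdiv_lt_0_compat; lra.
  - apply Rmult_lt_reg_r with (INR d - 1); [lra|]. field_simplify; lra.
Qed.

Lemma child_nonroot (d : nat) (c j : vertex) : In j (children d c) -> j <> [].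
Proof. intros Hj. apply in_children in Hj as [a [-> _]]. now destruct c. Qed.

Lemma frac_monotone (s t : R) : 0 <= s -> s <= t -> s / (1 + s) <= t / (1 + t).
Proof.
  intros H1 H2. apply Rmult_le_reg_r with ((1 + s) * (1 + t)); [nra|].
  replace (s / (1 + s) * ((1 + s) * (1 + t))) with (s * (1 + t)) by (field; lra).
  replace (t / (1 + t) * ((1 + s) * (1 + t))) with (t * (1 + s)) by (field; lra). lra.
Qed.

(** The recursion is increasing and starts from 1, above its fixed point, wherever the boundary of
    [P] lies. *)
Lemma pstrong_lower (d : nat) (P : vertex -> bool) (k : nat) (c : vertex) : (3 <= d)%nat ->
  reduced d c -> c <> [] -> pstar d <= pstrong d P k c.
Proof.
  intros Hd. assert (B := pstar_bounds d Hd). revert c.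
  induction k as [|k IH]; intros c Hc Hn; simpl; [lra|]. destruct (P c); [|lra].
  apply INR_ge_3 in Hd as Hd'.
  (* [INR d - 2] is the sum over [d - 1] children all at [pstar d]. *)
  replace (pstar d) with ((INR d - 2) / (1 + (INR d - 2))) by (unfold pstar; f_equal; ring).
  apply frac_monotone; [lra|].
  apply Rle_trans with (Rsum (children d c) (fun _ => pstar d)).
  - rewrite Rsum_const, length_children, minus_INR by (auto; lia). simpl (INR 1).
    unfold pstar. right. field. lra.
  - apply Rsum_le. intros j Hj. apply IH; [eapply children_reduced|eapply child_nonroot]; eauto.
Qed.

(* The recursion [s / (1 + s)] with [s] a sum of [d - 1] copies contracts by 1/2 above its fixed
   point [pstar d]. *)
Lemma pstrong_upper (d : nat) (P : vertex -> bool) (t k : nat) (c : vertex) : (3 <= d)%nat ->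
  reduced d c -> c <> [] -> (t <= k)%nat ->
  (forall s, (length s < t)%nat -> reduced d (c ++ s) -> P (c ++ s) = true) ->
  pstrong d P k c <= pstar d + (1 / 2) ^ t.
Proof.
  intros Hd. assert (B := pstar_bounds d Hd). apply INR_ge_3 in Hd as Hd'.
  revert k c. induction t as [|t IH]; intros k c Hc Hn Hk HP.
  - simpl. assert (B' := pstrong_bounds d P k c). lra.
  - destruct k as [|k]; [lia|]. simpl pstrong.
    assert (HPc : P c = true).
    { specialize (HP []). rewrite app_nil_r in HP. apply HP; [simpl; lia|assumption]. }
    rewrite HPc. set (e := (1 / 2) ^ t).
    assert (He : 0 < e) by (apply pow_lt; lra).
    apply Rle_trans with (((INR d - 1) * (pstar d + e)) / (1 + (INR d - 1) * (pstar d + e))).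
    + apply frac_monotone; [apply sum_pstrong_nonneg|].
      apply Rle_trans with (Rsum (children d c) (fun _ => pstar d + e)).
      * apply Rsum_le. intros j Hj. apply IH.
        -- eapply children_reduced; eauto.
        -- eapply child_nonroot; eauto.
        -- lia.
        -- intros s Hs Hr. apply in_children in Hj as [a [-> _]].
           rewrite <- app_assoc in *. apply HP; [simpl; lia|assumption].
      * rewrite Rsum_const, length_children, minus_INR by (auto; lia). simpl (INR 1). lra.
    (* The image of [pstar d + e] is [(pstar d + e) / (1 + e)], which exceeds [pstar d] by
       [e / ((d - 1) (1 + e))], at most [e / 2]. *)
    + replace (1 + (INR d - 1) * (pstar d + e)) with ((INR d - 1) * (1 + e))
        by (unfold pstar; field; lra).
      replace ((1 / 2) ^ S t) with (e / 2) by (unfold e; simpl; field).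
      apply Rmult_le_reg_r with ((INR d - 1) * (1 + e)); [nra|].
      unfold Rdiv at 1. rewrite Rmult_assoc, Rinv_l, Rmult_1_r by nra.
      unfold pstar.
      replace (((INR d - 2) / (INR d - 1) + e / 2) * ((INR d - 1) * (1 + e)))
        with ((INR d - 2) * (1 + e) + e / 2 * ((INR d - 1) * (1 + e))) by (field; lra).
      replace ((INR d - 1) * ((INR d - 2) / (INR d - 1) + e))
        with (INR d - 2 + (INR d - 1) * e) by (field; lra).
      assert (0 <= e * e * (INR d - 1)) by (apply Rmult_le_pos; [nra|lra]). nra.
Qed.

Lemma Un_cv_const (a : R) : Un_cv (fun _ => a) a.
Proof.
  intros e He. exists 0%nat. intros n _. unfold R_dist. rewrite Rminus_diag, Rabs_R0. assumption.
Qed.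

Lemma Un_cv_eventually (u v : nat -> R) (l : R) :
  (exists N, forall n, (N <= n)%nat -> u n = v n) -> Un_cv u l -> Un_cv v l.
Proof.
  intros [N H] Hu e He. destruct (Hu e He) as [M HM]. exists (max N M). intros n Hn.
  rewrite <- H by lia. apply HM. lia.
Qed.

Lemma Un_cv_ext (u v : nat -> R) (l : R) : (forall n, u n = v n) -> Un_cv u l -> Un_cv v l.
Proof. intros H. apply Un_cv_eventually. exists 0%nat. auto. Qed.

Lemma Un_cv_div (u v : nat -> R) (a b : R) : b <> 0 -> Un_cv u a -> Un_cv v b ->
  Un_cv (fun n => u n / v n) (a / b).
Proof.
  intros Hb Hu Hv. apply CV_mult; [assumption|].
  apply (continuity_seq Rinv v b); [|assumption].
  apply (continuity_pt_inv id b); [apply derivable_continuous_pt, derivable_pt_id|exact Hb].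
Qed.

Lemma Un_cv_Rsum (A : Type) (l : list A) (u : nat -> A -> R) (a : A -> R) :
  (forall x, In x l -> Un_cv (fun n => u n x) (a x)) -> Un_cv (fun n => Rsum l (u n)) (Rsum l a).
Proof.
  induction l as [|x l IH]; intros H; simpl; [apply Un_cv_const|].
  apply CV_plus; [apply H; now left|apply IH; intros; apply H; now right].
Qed.

Lemma Un_cv_wexp (u : nat -> vertex -> bool -> R) (a : vertex -> bool -> R) (js : list vertex)
  (g : nat -> R) : (forall j b, In j js -> Un_cv (fun n => u n j b) (a j b)) ->
  Un_cv (fun n => wexp (u n) js g) (wexp a js g).
Proof.
  revert g. induction js as [|j js IH]; intros g H; simpl; [apply Un_cv_const|].
  assert (Hj : forall b, Un_cv (fun n => u n j b) (a j b)) by (intros; apply H; now left).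
  assert (IH' : forall g, Un_cv (fun n => wexp (u n) js g) (wexp a js g))
    by (intros; apply IH; intros; apply H; now right).
  apply CV_plus; apply CV_mult; auto.
Qed.

Lemma Un_cv_vweight (d : nat) (cst : vertex -> nat -> bool) (u : nat -> vertex -> bool -> R)
  (a : vertex -> bool -> R) (c : vertex) (g : bool -> R) :
  (forall j b, In j (children d c) -> Un_cv (fun n => u n j b) (a j b)) ->
  Un_cv (fun n => vweight d cst (u n) c g) (vweight d cst a c g).
Proof.
  intros H. unfold vweight.
  apply (Un_cv_Rsum _ (seq 0 d) (fun n h => wexp (u n) (children d c)
     (fun m => if cst c h && Nat.leb m h then g (Nat.leb h m) else 0))).
  intros h _. now apply Un_cv_wexp.
Qed.

Lemma exhaustion_mono (d : nat) (V : nat -> list vertex) (m n : nat) (w : vertex) :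
  exhaustion d V -> (m <= n)%nat -> In w (V m) -> In w (V n).
Proof. intros [_ [H _]] Hmn Hw. induction Hmn; auto. Qed.

Lemma exhaustion_incl (d : nat) (V : nat -> list vertex) (l : list vertex) :
  exhaustion d V -> within d l -> exists N, forall n, (N <= n)%nat -> incl l (V n).
Proof.
  intros HV. induction l as [|w l IH]; intros Hl.
  - exists 0%nat. intros n _ ? [].
  - destruct IH as [N HN]; [intros x Hx; apply Hl; now right|].
    destruct HV as [H1 [H2 H3]]. destruct (H3 w) as [M HM]; [apply Hl; now left|].
    exists (max N M). intros n Hn x [<-|Hx].
    + apply exhaustion_mono with d M; [repeat split; auto|lia|assumption].
    + apply (HN n); [lia|assumption].
Qed.

Definition ball (d n : nat) : list vertex := tv d (fun _ => true) n [].

Lemma in_ball (d n : nat) (x : vertex) : In x (ball d n) <-> (length x < n)%nat /\ reduced d x.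
Proof.
  unfold ball. rewrite in_tv by exact I. split.
  - intros [s [-> [Hs [Hr _]]]]. auto.
  - intros [H1 H2]. exists x. auto.
Qed.

Definition to_infinity (K : nat -> nat) : Prop :=
  forall t, exists N, forall n, (N <= n)%nat -> (t <= K n)%nat.

Lemma pstrong_cv (d : nat) (V : nat -> list vertex) (K : nat -> nat) (c : vertex) :
  (3 <= d)%nat -> exhaustion d V -> to_infinity K -> reduced d c -> c <> [] ->
  Un_cv (fun n => pstrong d (inVb (V n)) (K n) c) (pstar d).
Proof.
  intros Hd HV HK Hc Hn e He.
  destruct (pow_lt_1_zero (1 / 2)) with (y := e) as [t Ht]; [rewrite Rabs_pos_eq; lra|assumption|].
  specialize (Ht t (le_n t)). rewrite Rabs_pos_eq in Ht by (apply pow_le; lra).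
  (* This ball contains the first [t] levels of the branch at [c]. *)
  destruct (exhaustion_incl d V (ball d (length c + t))) as [N HN]; [assumption| |].
  { intros w Hw. now apply in_ball in Hw. }
  destruct (HK t) as [M HM]. exists (max N M). intros n Hn'.
  assert (L := pstrong_lower d (inVb (V n)) (K n) c Hd Hc Hn).
  assert (U : pstrong d (inVb (V n)) (K n) c <= pstar d + (1 / 2) ^ t).
  { apply pstrong_upper; auto; [apply HM; lia|].
    intros s Hs Hr. apply inVb_iff, (HN n); [lia|]. apply in_ball.
    rewrite length_app. split; [lia|assumption]. }
  unfold R_dist. rewrite Rabs_pos_eq; lra.
Qed.

(** The limit of [nweight], where [i] counts the levels that may still be constrained; below them
    every vertex is strong with probability [pstar d]. The divisor is [1 + (d - 1) pstar d]. *)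
Fixpoint nlim (d : nat) (cst : vertex -> nat -> bool) (i : nat) (c : vertex) (b : bool) : R :=
  match i with
  | O => if b then 1 - pstar d else pstar d
  | S i => vweight d cst (nlim d cst i) c (fun b' => if eqb b' b then 1 else 0) / (INR d - 1)
  end.

(** The induction runs over the constrained levels, whose number is fixed, while the depth [K n]
    grows; [K] is general because each level lowers it by one. *)
Lemma nweight_cv (d : nat) (cst : vertex -> nat -> bool) (i : nat) (c : vertex) (b : bool)
  (V : nat -> list vertex) (K : nat -> nat) : (3 <= d)%nat ->
  exhaustion d V -> to_infinity K -> reduced d c -> c <> [] ->
  (forall s h, (i <= length s)%nat -> cst (c ++ s) h = true) ->
  Un_cv (fun n => nweight d (inVb (V n)) cst (K n) c b) (nlim d cst i c b).
Proof.
  intros Hd HV. revert K c b. induction i as [|i IH]; intros K c b HK Hc Hn Hcst.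
  - simpl. apply Un_cv_ext with (fun n => if b then 1 - pstrong d (inVb (V n)) (K n) c
                                          else pstrong d (inVb (V n)) (K n) c).
    + intros n. rewrite (nweight_ext d (inVb (V n)) cst free) by (intros; apply Hcst; lia).
      destruct (nweight_free d (inVb (V n)) (K n) c) as [E1 E2]; auto; [lia|].
      destruct b; auto.
    + assert (H := pstrong_cv d V K c Hd HV HK Hc Hn).
      destruct b; [|assumption]. apply CV_minus; [apply Un_cv_const|assumption].
  - set (K' := fun n => pred (K n)).
    assert (HK' : to_infinity K').
    { intros t. destruct (HK (S t)) as [N HN]. exists N. intros n Hle. specialize (HN n Hle).
      unfold K'. lia. }
    apply Un_cv_eventually with (fun n =>
      vweight d cst (nweight d (inVb (V n)) cst (K' n)) c (fun b' => if eqb b' b then 1 else 0)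
      / (1 + Rsum (children d c) (pstrong d (inVb (V n)) (K' n)))).
    + destruct (HK 1%nat) as [N HN].
      destruct (exhaustion_incl d V [c]) as [M HM]; [assumption|intros w [<-|[]]; assumption|].
      exists (max N M). intros n Hle. unfold K'.
      assert (HKn : (1 <= K n)%nat) by (apply HN; lia).
      destruct (K n) as [|k]; [lia|]. simpl.
      assert (Hin : In c (V n)) by (apply (HM n); [lia|now left]).
      apply inVb_iff in Hin. now rewrite Hin.
    + cbn [nlim]. apply INR_ge_3 in Hd as Hd'. apply Un_cv_div; [lra| |].
      * apply Un_cv_vweight. intros j b' Hj. apply IH; auto.
        -- eapply children_reduced; eauto.
        -- eapply child_nonroot; eauto.
        -- intros s h Hs. apply in_children in Hj as [a [-> _]]. rewrite <- app_assoc.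
           apply Hcst. simpl. lia.
      * replace (INR d - 1) with (1 + Rsum (children d c) (fun _ => pstar d)).
        -- apply CV_plus; [apply Un_cv_const|].
           apply (Un_cv_Rsum _ _ (fun n => pstrong d (inVb (V n)) (K' n))).
           intros j Hj. apply pstrong_cv; auto;
             [eapply children_reduced|eapply child_nonroot]; eauto.
        -- rewrite Rsum_const, length_children, minus_INR by (auto; lia). simpl (INR 1).
           unfold pstar. field. lra.
Qed.

(** * Cylinder probabilities in finite volume and their limits *)

Definition agree_cst (A : list vertex) (xi : vertex -> nat) (w : vertex) (h : nat) : bool :=
  if inVb A w then Nat.eqb h (xi w) else true.

Definition reclist (d K : nat) (V : list vertex) : list (vertex -> nat) :=
  filter (fun eta => okb d (inVb V) free eta K []) (confs d (tv d (inVb V) K []) (fun _ => 0%nat)).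

Definition deep (K : nat) (V : list vertex) : Prop := forall w, In w V -> (length w < K)%nat.

Lemma in_tv_root (d K : nat) (V : list vertex) (w : vertex) : within d V -> deep K V ->
  (In w (tv d (inVb V) K []) <-> In w V).
Proof.
  intros HV HK. rewrite in_tv by exact I. split.
  - intros [s [_ [_ [_ H]]]]. now apply inVb_iff.
  - intros H. exists w. apply inVb_iff in H as H'. auto.
Qed.

Lemma in_reclist (d K : nat) (V : list vertex) (eta : vertex -> nat) : (3 <= d)%nat -> within d V ->
  deep K V -> (In eta (reclist d K V) <-> recurrent d V eta).
Proof.
  intros Hd HV HK. unfold reclist. rewrite filter_In, in_confs by (apply NoDup_tv; exact I).
  rewrite okb_root_iff, recurrent_iff_allowed by assumption. unfold stable, supported.
  split.
  - intros [[H1 H2] [H3 _]]. repeat split; auto; intros w Hw.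
    + apply H1. now apply in_tv_root.
    + apply H2. rewrite in_tv_root; auto.
  - intros [H1 [H2 H3]]. repeat split; auto; intros w Hw; try rewrite in_tv_root in Hw; auto.
Qed.

Lemma NoDup_reclist (d K : nat) (V : list vertex) : NoDup (reclist d K V).
Proof. apply NoDup_filter, NoDup_confs, NoDup_tv. exact I. Qed.

Definition cylprob (d K : nat) (V A : list vertex) (xi : vertex -> nat) : R :=
  INR (length (filter (fun eta => agreeb A eta xi) (reclist d K V))) / INR (length (reclist d K V)).

Lemma unif_cyl_cylprob (d K : nat) (V A : list vertex) (xi : vertex -> nat) : (3 <= d)%nat ->
  within d V -> deep K V -> unif_cyl (recurrent d V) A xi (cylprob d K V A xi).
Proof.
  intros Hd HV HK. exists (reclist d K V). split; [apply NoDup_reclist|].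
  split; [intros eta; now apply in_reclist|reflexivity].
Qed.

(** The product of the [znorm] does not involve [cst], so it cancels when the constrained count is
    divided by the free one. *)
Lemma reclist_count (d K : nat) (V : list vertex) (cst : vertex -> nat -> bool)
  (f : (vertex -> nat) -> bool) : within d V -> deep (S K) V -> In [] V ->
  (forall eta, f eta = true <-> forall w, In w V -> cst w (eta w) = true) ->
  INR (length (filter f (reclist d (S K) V))) =
  Rprod (children d []) (znorm d (inVb V) K) *
  vweight d cst (nweight d (inVb V) cst K) [] (fun _ => 1).
Proof.
  intros HV HK H0 Hf.
  rewrite <- (csum_vertex d (inVb V) cst K [] (fun _ => 0%nat)); [|exact I|now apply inVb_iff|].
  2:{ intros j e g Hj. apply csum_branch. eapply children_reduced; [|exact Hj]. exact I. }
  rewrite <- Rsum_indicator. unfold reclist, csum.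
  generalize (confs d (tv d (inVb V) (S K) []) (fun _ => 0%nat)) as L.
  induction L as [|eta L IH]; [reflexivity|].
  cbn [filter]. cbn [Rsum fold_right]. fold (Rsum L) in *. unfold Rsum in IH. rewrite <- IH. clear IH.
  assert (E : okb d (inVb V) cst eta (S K) [] = okb d (inVb V) free eta (S K) [] && f eta).
  { apply eq_iff_eq_true. rewrite andb_true_iff, !okb_root_iff, Hf by assumption.
    unfold free. intuition. }
  rewrite E. destruct (okb d (inVb V) free eta (S K) []). 2: { symmetry. apply Rplus_0_l. }
  reflexivity.
Qed.

Lemma cylprob_formula (d K : nat) (V A : list vertex) (xi : vertex -> nat) : (3 <= d)%nat ->
  within d V -> deep (S K) V -> In [] V -> incl A V ->
  cylprob d (S K) V A xi =
  vweight d (agree_cst A xi) (nweight d (inVb V) (agree_cst A xi) K) [] (fun _ => 1)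
  / Rsum (children d []) (pstrong d (inVb V) K).
Proof.
  intros Hd HV HK H0 HA. unfold cylprob.
  rewrite (reclist_count d K V (agree_cst A xi)); auto.
  2:{ intros eta. unfold agreeb. rewrite forallb_forall. unfold agree_cst. split.
      - intros H w _. destruct (inVb A w) eqn:E; [apply H; now apply inVb_iff|reflexivity].
      - intros H w Hw. specialize (H w (HA w Hw)). rewrite (proj2 (inVb_iff A w) Hw) in H. exact H. }
  rewrite <- (filter_true (reclist d (S K) V)) at 1.
  rewrite (reclist_count d K V free); auto; [|intros; split; reflexivity].
  assert (Hz : 0 < Rprod (children d []) (znorm d (inVb V) K))
    by (apply Rprod_pos; intros; apply znorm_pos).
  assert (Hj : forall j, In j (children d []) -> reduced d j /\ j <> []).
  { intros j Hj. split; [eapply children_reduced; [|exact Hj]; exact I|eapply child_nonroot; eauto]. }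
  (* At the root all [d] neighbours are children: [m] weak ones leave [d - m] heights, as many as
     there are strong children. *)
  assert (E : vweight d free (nweight d (inVb V) free K) [] (fun _ => 1) =
          Rsum (children d []) (pstrong d (inVb V) K)).
  { rewrite vweight_free. rewrite (wexp_ext _ _ _ (fun m => INR d - INR m)).
    - rewrite wexp_linear, length_children_root.
      + unfold Rminus. rewrite Rplus_opp_r, Rplus_0_l. apply Rsum_ext. intros j Hj'.
        apply Hj in Hj' as [? ?]. apply nweight_free; auto; lia.
      + intros j Hj'. apply Hj in Hj' as [H1 H2].
        destruct (nweight_free d (inVb V) K j) as [-> ->]; auto; [lia|ring].
    - intros m Hm. rewrite length_children_root in Hm. now apply count_ge. }
  rewrite E.
  assert (Hs : 0 < Rsum (children d []) (pstrong d (inVb V) K)).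
  { apply Rlt_le_trans with (Rsum (children d []) (fun _ => pstar d)).
    - rewrite Rsum_const, length_children_root. apply Rmult_lt_0_compat.
      + apply INR_ge_3 in Hd. lra.
      + now apply pstar_bounds.
    - apply Rsum_le. intros j Hj'. apply Hj in Hj' as [? ?]. now apply pstrong_lower. }
  field. lra.
Qed.

(** The successor makes the bound strict, and positive also for the empty list. *)
Definition depth (A : list vertex) : nat := S (list_max (map (@length nat) A)).

Lemma deep_depth (A : list vertex) (k : nat) : deep (k + depth A) A.
Proof.
  intros w Hw. unfold depth.
  assert (L := proj1 (list_max_le (map (@length nat) A) _) (le_n _)).
  rewrite Forall_forall in L. specialize (L (length w) (in_map _ _ _ Hw)). lia.
Qed.

Definition cyllim (d : nat) (A : list vertex) (xi : vertex -> nat) : R :=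
  vweight d (agree_cst A xi) (nlim d (agree_cst A xi) (depth A)) [] (fun _ => 1)
  / (INR d * pstar d).

Lemma cylprob_cv (d : nat) (V : nat -> list vertex) (A : list vertex) (xi : vertex -> nat) :
  (3 <= d)%nat -> exhaustion d V -> within d A ->
  Un_cv (fun n => cylprob d (n + depth (V n)) (V n) A xi) (cyllim d A xi).
Proof.
  (* The summand [n] makes the depths tend to infinity by construction; the root uses up one level,
     hence [pred]. *)
  intros Hd HV HA. set (K := fun n => pred (n + depth (V n))).
  assert (HK : to_infinity K).
  { intros t. exists t. intros n Hn. unfold K, depth. lia. }
  assert (Hj : forall j, In j (children d []) -> reduced d j /\ j <> []).
  { intros j Hj. split; [eapply children_reduced; [|exact Hj]; exact I|eapply child_nonroot; eauto]. }
  apply Un_cv_eventually with (fun n =>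
     vweight d (agree_cst A xi) (nweight d (inVb (V n)) (agree_cst A xi) (K n)) [] (fun _ => 1)
     / Rsum (children d []) (pstrong d (inVb (V n)) (K n))).
  - destruct (exhaustion_incl d V ([] :: A)) as [N HN]; [assumption| |].
    { intros w [<-|Hw]; [exact I|auto]. }
    exists N. intros n Hn. specialize (HN n Hn).
    assert (EK : (n + depth (V n) = S (K n))%nat) by (unfold K, depth; lia).
    rewrite EK, cylprob_formula; auto.
    + destruct HV as [HV _]. intros w. apply HV.
    + rewrite <- EK. apply deep_depth.
    + apply HN. now left.
    + intros w Hw. apply HN. now right.
  - assert (B := pstar_bounds d Hd). apply INR_ge_3 in Hd as Hd'.
    apply Un_cv_div; [apply Rgt_not_eq, Rmult_lt_0_compat; lra| |].
    + apply Un_cv_vweight. intros j b Hj'. apply Hj in Hj' as Hj''. destruct Hj'' as [H1 H2].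
      apply nweight_cv; auto. intros s h Hs. unfold agree_cst.
      destruct (inVb A (j ++ s)) eqn:E; [|reflexivity]. apply inVb_iff in E.
      apply (deep_depth A 0) in E. rewrite length_app in E. lia.
    + replace (INR d * pstar d) with (Rsum (children d []) (fun _ => pstar d))
        by now rewrite Rsum_const, length_children_root.
      apply (Un_cv_Rsum _ _ (fun n => pstrong d (inVb (V n)) (K n))).
      intros j Hj'. apply Hj in Hj' as [? ?]. now apply pstrong_cv.
Qed.

(** * Sampling from nested interval partitions *)

Lemma exhaustion_ball (d : nat) : exhaustion d (ball d).
Proof.
  split; [|split].
  - intros n w Hw. now apply in_ball in Hw.
  - intros n w Hw. apply in_ball in Hw. apply in_ball. split; [lia|tauto].
  - intros w Hw. exists (S (length w)). apply in_ball. auto.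
Qed.

(** Identities for [cyllim] are derived from the counts on balls by uniqueness of limits, not from
    its formula. *)
Lemma cyllim_unique (d : nat) (A : list vertex) (xi : vertex -> nat) (l : R) : (3 <= d)%nat ->
  within d A ->
  Un_cv (fun n => cylprob d (n + depth (ball d n)) (ball d n) A xi) l -> l = cyllim d A xi.
Proof.
  intros Hd HA H. apply (UL_sequence _ _ _ H).
  apply cylprob_cv; auto. apply exhaustion_ball.
Qed.

Lemma cylprob_nonneg (d K : nat) (V A : list vertex) (xi : vertex -> nat) : 0 <= cylprob d K V A xi.
Proof.
  unfold cylprob, Rdiv. destruct (reclist d K V) as [|eta L].
  - simpl. lra.
  - apply Rmult_le_pos; [apply pos_INR|]. left. apply Rinv_0_lt_compat, lt_0_INR. simpl. lia.
Qed.

Lemma cyllim_nonneg (d : nat) (A : list vertex) (xi : vertex -> nat) : (3 <= d)%nat -> within d A ->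
  0 <= cyllim d A xi.
Proof.
  intros Hd HA. apply Rle_cv_lim with (fun _ => 0) (fun n => cylprob d (n + depth (ball d n)) (ball d n) A xi).
  - intros n. apply cylprob_nonneg.
  - apply Un_cv_const.
  - apply cylprob_cv; auto. apply exhaustion_ball.
Qed.

Lemma reclist_nonempty (d K : nat) (V : list vertex) : (3 <= d)%nat -> within d V -> deep K V ->
  (0 < length (reclist d K V))%nat.
Proof.
  intros Hd HV HK. assert (H : In (full d V) (reclist d K V)).
  { apply in_reclist; auto. apply recurrent_iff_allowed; auto. split; [|split].
    - intros w Hw. unfold full. rewrite (proj2 (inVb_iff V w) Hw). lia.
    - intros w Hw. unfold full. now rewrite (proj2 (inVb_false V w) Hw).
    - apply allowed_full; auto. lia. }
  destruct (reclist d K V); [destruct H|simpl; lia].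
Qed.

Lemma within_ball (d n : nat) : within d (ball d n).
Proof. intros w Hw. now apply in_ball in Hw. Qed.

Lemma cyllim_nil (d : nat) (xi : vertex -> nat) : (3 <= d)%nat -> cyllim d [] xi = 1.
Proof.
  intros Hd. symmetry. apply cyllim_unique; [assumption|intros ? []|].
  apply Un_cv_ext with (fun _ => 1); [|apply Un_cv_const]. intros n. unfold cylprob.
  assert (L := reclist_nonempty d (n + depth (ball d n)) (ball d n) Hd (within_ball d n) (deep_depth _ _)).
  simpl agreeb. rewrite filter_true. apply lt_INR in L. simpl in L. field. lra.
Qed.

Lemma cyllim_ext (d : nat) (A B : list vertex) (xi zeta : vertex -> nat) : (3 <= d)%nat -> within d A ->
  incl A B -> incl B A -> (forall w, In w A -> xi w = zeta w) -> cyllim d A xi = cyllim d B zeta.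
Proof.
  intros Hd HA HAB HBA Hxi.
  assert (HB : within d B) by (intros w Hw; auto).
  apply cyllim_unique; auto.
  apply Un_cv_ext with (fun n => cylprob d (n + depth (ball d n)) (ball d n) A xi);
    [|apply cylprob_cv; auto; apply exhaustion_ball].
  intros n. unfold cylprob. f_equal. f_equal. f_equal. apply filter_ext. intros eta.
  apply eq_iff_eq_true. unfold agreeb. rewrite !forallb_forall. split; intros H w Hw.
  - rewrite <- Hxi by auto. apply H. auto.
  - rewrite Hxi by auto. apply H. auto.
Qed.

Lemma reclist_lt (d K : nat) (V : list vertex) (eta : vertex -> nat) (w : vertex) : (3 <= d)%nat ->
  within d V -> deep K V -> In eta (reclist d K V) -> (eta w < d)%nat.
Proof.
  intros Hd HV HK H. apply in_reclist in H as [H1 [H2 _]]; auto.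
  destruct (in_dec (list_eq_dec Nat.eq_dec) w V) as [Hw|Hw]; [auto|]. rewrite H2 by assumption. lia.
Qed.

Lemma cyllim_zero (d : nat) (A : list vertex) (xi : vertex -> nat) (w : vertex) : (3 <= d)%nat ->
  within d A -> In w A -> (d <= xi w)%nat -> cyllim d A xi = 0.
Proof.
  intros Hd HA Hw Hxi. symmetry. apply cyllim_unique; auto.
  apply Un_cv_ext with (fun _ => 0); [|apply Un_cv_const]. intros n. unfold cylprob.
  rewrite (filter_ext_in _ (fun _ => false)), filter_false.
  - simpl. unfold Rdiv. ring.
  - intros eta He. apply reclist_lt with (w := w) in He; auto using within_ball, deep_depth.
    apply not_true_iff_false. unfold agreeb. rewrite forallb_forall. intros E.
    specialize (E w Hw). apply Nat.eqb_eq in E. lia.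
Qed.

(** Kolmogorov consistency: each configuration in the finite list is counted for exactly one [a],
    namely [eta w], which is below [d]. *)
Lemma cyllim_cons (d : nat) (A : list vertex) (xi : vertex -> nat) (w : vertex) : (3 <= d)%nat ->
  within d A -> reduced d w -> ~ In w A ->
  cyllim d A xi = Rsum (seq 0 d) (fun a => cyllim d (w :: A) (upd xi w a)).
Proof.
  intros Hd HA Hw Hn. symmetry. apply cyllim_unique; auto.
  apply Un_cv_ext with (fun n => Rsum (seq 0 d) (fun a =>
    cylprob d (n + depth (ball d n)) (ball d n) (w :: A) (upd xi w a))).
  2:{ apply (Un_cv_Rsum _ (seq 0 d) (fun n a =>
      cylprob d (n + depth (ball d n)) (ball d n) (w :: A) (upd xi w a))).
      intros a _. apply cylprob_cv; auto; [apply exhaustion_ball|].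
      intros v [<-|Hv]; auto. }
  intros n. unfold cylprob, Rdiv.
  rewrite (Rsum_ext _ _ _ (fun a => / INR (length (reclist d (n + depth (ball d n)) (ball d n))) *
    INR (length (filter (fun eta => agreeb (w :: A) eta (upd xi w a))
      (reclist d (n + depth (ball d n)) (ball d n)))))) by (intros; ring).
  rewrite Rsum_scal, Rmult_comm. f_equal.
  assert (HL : forall eta, In eta (reclist d (n + depth (ball d n)) (ball d n)) -> (eta w < d)%nat).
  { intros eta. apply reclist_lt; auto using within_ball, deep_depth. }
  revert HL. generalize (reclist d (n + depth (ball d n)) (ball d n)) as L.
  assert (E : forall eta a, agreeb (w :: A) eta (upd xi w a) = Nat.eqb (eta w) a && agreeb A eta xi).
  { intros eta a. unfold agreeb. simpl. rewrite upd_same. f_equal. apply forallb_ext_in.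
    intros v Hv. now rewrite upd_other by congruence. }
  induction L as [|eta L IH]; intros HL.
  - simpl. rewrite Rsum_const. ring.
  - rewrite (Rsum_ext _ _ _ (fun a => (if Nat.eqb (eta w) a && agreeb A eta xi then 1 else 0) +
       INR (length (filter (fun eta => agreeb (w :: A) eta (upd xi w a)) L)))).
    + rewrite Rsum_plus, IH by (intros; apply HL; now right). clear IH.
      cbn [filter]. destruct (agreeb A eta xi).
      * change (length (eta :: filter (fun e => agreeb A e xi) L)) with
          (S (length (filter (fun e => agreeb A e xi) L))). rewrite S_INR, Rplus_comm. f_equal.
        etransitivity; [|apply (count_eq (eta w) d), HL; now left].
        apply Rsum_ext. intros a _. rewrite andb_true_r.
        destruct (Nat.eqb_spec (eta w) a), (Nat.leb_spec (eta w) a), (Nat.leb_spec a (eta w));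
          try lia; reflexivity.
      * rewrite (Rsum_ext _ _ _ (fun _ => 0)), Rsum_const; [ring|].
        intros a _. now rewrite andb_false_r.
    + intros a _. cbn [filter]. rewrite E. destruct (Nat.eqb (eta w) a && agreeb A eta xi).
      * change (length (?x :: ?l)) with (S (length l)). cbn [length]. rewrite S_INR. ring.
      * ring.
Qed.

(** * Enumeration of the vertices *)

Fixpoint code (w : list nat) : nat :=
  match w with [] => 0%nat | a :: w => S (Cantor.to_nat (a, code w)) end.

Lemma code_inj (v w : list nat) : code v = code w -> v = w.
Proof.
  revert w. induction v as [|a v IH]; intros [|b w] E; try discriminate; [reflexivity|].
  cbn [code] in E. apply Nat.succ_inj, Cantor.to_nat_inj in E. injection E as -> E. f_equal. auto.
Qed.

Definition decode (d N : nat) : option vertex :=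
  match excluded_middle_informative (exists w, reduced d w /\ code w = N) with
  | left H => Some (proj1_sig (constructive_indefinite_description _ H))
  | right _ => None
  end.

Lemma decode_some (d N : nat) (w : vertex) : decode d N = Some w <-> reduced d w /\ code w = N.
Proof.
  unfold decode. destruct excluded_middle_informative as [H|H].
  - destruct constructive_indefinite_description as [v [H1 H2]]. simpl. split.
    + intros E. injection E as <-. auto.
    + intros [H3 H4]. f_equal. apply code_inj. congruence.
  - split; [discriminate|]. intros E. exfalso. eauto.
Qed.

Fixpoint coded_below (d N : nat) : list vertex :=
  match N with
  | O => []
  | S N => match decode d N with Some w => w :: coded_below d N | None => coded_below d N end
  end.

Lemma in_coded_below (d N : nat) (w : vertex) : In w (coded_below d N) <-> reduced d w /\ (code w < N)%nat.
Proof.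
  induction N as [|N IH]; simpl; [split; [intros []|lia]|].
  destruct (decode d N) as [v|] eqn:E.
  - apply decode_some in E as [E1 E2]. simpl. rewrite IH. split.
    + intros [<-|[H1 H2]]; split; auto; lia.
    + intros [H1 H2]. destruct (Nat.eq_dec (code w) N) as [Ew|Ew].
      * left. apply code_inj. congruence.
      * right. split; [assumption|lia].
  - rewrite IH. split; [intros [H1 H2]; split; auto|].
    intros [H1 H2]. split; [assumption|].
    assert (code w <> N); [|lia]. intros Ew.
    assert (F : decode d N = Some w) by now apply decode_some. congruence.
Qed.

(* Values are listed in decreasing order of the codes of the vertices they belong to. *)
Definition config_of (l : list nat) (w : vertex) : nat := nth (length l - S (code w)) l 0%nat.

Lemma config_of_last (a : nat) (l : list nat) (w : vertex) : code w = length l -> config_of (a :: l) w = a.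
Proof. intros E. unfold config_of. simpl length. now rewrite E, Nat.sub_diag. Qed.

Lemma config_of_earlier (a : nat) (l : list nat) (w : vertex) : (code w < length l)%nat ->
  config_of (a :: l) w = config_of l w.
Proof.
  intros H. unfold config_of. simpl length.
  now replace (S (length l) - S (code w))%nat with (S (length l - S (code w))) by lia.
Qed.

(** Numbers that code no vertex get a single dummy value, so that positions in a list of values
    match codes. *)
Definition choices (d N : nat) : nat := match decode d N with Some _ => d | None => 1%nat end.

Definition prefix_prob (d : nat) (l : list nat) : R :=
  cyllim d (coded_below d (length l)) (config_of l).

Lemma within_coded_below (d N : nat) : within d (coded_below d N).
Proof. intros w Hw. now apply in_coded_below in Hw. Qed.

Lemma prefix_prob_nonneg (d : nat) (l : list nat) : (3 <= d)%nat -> 0 <= prefix_prob d l.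
Proof. intros Hd. apply cyllim_nonneg; auto using within_coded_below. Qed.

Lemma prefix_prob_split (d : nat) (l : list nat) : (3 <= d)%nat ->
  prefix_prob d l = Rsum (seq 0 (choices d (length l))) (fun a => prefix_prob d (a :: l)).
Proof.
  intros Hd. unfold prefix_prob at 1, choices.
  destruct (decode d (length l)) as [w|] eqn:E.
  - apply decode_some in E as E'. destruct E' as [Hw Ew].
    rewrite (cyllim_cons d _ _ w); auto using within_coded_below.
    + apply Rsum_ext. intros a _. unfold prefix_prob. simpl length. simpl coded_below. rewrite E.
      apply cyllim_ext; auto using incl_refl.
      * intros v [<-|Hv]; [assumption|]. now apply within_coded_below in Hv.
      * intros v [<-|Hv].
        -- now rewrite upd_same, config_of_last.
        -- apply in_coded_below in Hv as [_ Hv]. rewrite config_of_earlier by assumption.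
           apply upd_other. intros ->. lia.
    + intros Hv. apply in_coded_below in Hv as [_ Hv]. lia.
  - cbn. rewrite Rplus_0_r. unfold prefix_prob. simpl length. simpl coded_below. rewrite E.
    apply cyllim_ext; auto using incl_refl, within_coded_below.
    intros v Hv. apply in_coded_below in Hv as [_ Hv]. now rewrite config_of_earlier.
Qed.

Definition psum (f : nat -> R) (n : nat) : R := Rsum (seq 0 n) f.

Lemma psum_S (f : nat -> R) (n : nat) : psum f (S n) = psum f n + f n.
Proof. unfold psum. rewrite seq_S, Rsum_app. simpl. ring. Qed.

Lemma psum_mono (f : nat -> R) (m n : nat) : (forall a, 0 <= f a) -> (m <= n)%nat -> psum f m <= psum f n.
Proof.
  intros Hf H. induction H as [|n H IH]; [lra|]. rewrite psum_S. specialize (Hf n). lra.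
Qed.

(** The largest [a < n] with [psum f a <= y], by default 0; searching from the top skips intervals
    of length zero. *)
Fixpoint slot (f : nat -> R) (y : R) (n : nat) : nat :=
  match n with
  | O => 0%nat
  | S n => if Rle_dec (psum f n) y then n else slot f y n
  end.

Lemma slot_lt (f : nat -> R) (y : R) (n : nat) : (1 <= n)%nat -> (slot f y n < n)%nat.
Proof.
  induction n as [|n IH]; [lia|]. intros _. simpl. destruct (Rle_dec (psum f n) y); [lia|].
  destruct n; [simpl; lia|]. assert (slot f y (S n) < S n)%nat by (apply IH; lia). lia.
Qed.

Lemma slot_spec (f : nat -> R) (y : R) (n : nat) : 0 <= y < psum f n ->
  psum f (slot f y n) <= y < psum f (S (slot f y n)).
Proof.
  induction n as [|n IH]; intros H.
  - unfold psum in H. simpl in H. lra.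
  - simpl. destruct (Rle_dec (psum f n) y); [lra|]. apply IH. lra.
Qed.

Lemma slot_unique (f : nat -> R) (y : R) (n a : nat) : (forall a, 0 <= f a) ->
  (a < n)%nat -> psum f a <= y < psum f (S a) -> slot f y n = a.
Proof.
  intros Hf Ha H.
  assert (Hy : 0 <= y < psum f n).
  { assert (M0 := psum_mono f 0 a Hf ltac:(lia)). assert (Mn := psum_mono f (S a) n Hf ltac:(lia)).
    unfold psum at 1 in M0. simpl in M0. lra. }
  apply slot_spec in Hy.
  destruct (Nat.lt_trichotomy (slot f y n) a) as [L|[E|L]]; [|assumption|].
  - assert (M := psum_mono f (S (slot f y n)) a Hf L). lra.
  - assert (M := psum_mono f (S a) (slot f y n) Hf L). lra.
Qed.

(* Configurations on the vertices of code below [length l] are the cells [lower l, lower l +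
   prefix_prob l) of nested partitions of [0, 1), so that a uniform point of [0, 1) is mapped to
   a configuration with the prescribed cylinder probabilities. *)
Fixpoint lower (d : nat) (l : list nat) : R :=
  match l with
  | [] => 0
  | a :: l => lower d l + psum (fun b => prefix_prob d (b :: l)) a
  end.

Definition cell (d : nat) (l : list nat) (x : R) : Prop :=
  lower d l <= x < lower d l + prefix_prob d l.

Fixpoint valid (d : nat) (l : list nat) : Prop :=
  match l with [] => True | a :: l => (a < choices d (length l))%nat /\ valid d l end.

(** The first [N] digits of [x] in the nested partitions, the newest in front. *)
Fixpoint address (d : nat) (x : R) (N : nat) : list nat :=
  match N with
  | O => []
  | S N => let l := address d x N in
      slot (fun b => prefix_prob d (b :: l)) (x - lower d l) (choices d N) :: l
  end.

Lemma length_address (d : nat) (x : R) (N : nat) : length (address d x N) = N.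
Proof. induction N; simpl; congruence. Qed.

Lemma choices_pos (d N : nat) : (3 <= d)%nat -> (1 <= choices d N)%nat.
Proof. unfold choices. destruct (decode d N); lia. Qed.

Lemma valid_address (d : nat) (x : R) (N : nat) : (3 <= d)%nat -> valid d (address d x N).
Proof.
  intros Hd. induction N as [|N IH]; simpl; [exact I|]. split; [|assumption].
  rewrite length_address. apply slot_lt. now apply choices_pos.
Qed.

Lemma cell_nil (d : nat) (x : R) : (3 <= d)%nat -> (cell d [] x <-> 0 <= x < 1).
Proof.
  intros Hd. unfold cell, prefix_prob. simpl. rewrite cyllim_nil by assumption.
  rewrite Rplus_0_l. reflexivity.
Qed.

Lemma cell_cons (d : nat) (a : nat) (l : list nat) (x : R) :
  cell d (a :: l) x <->
  psum (fun b => prefix_prob d (b :: l)) a <= x - lower d l < psum (fun b => prefix_prob d (b :: l)) (S a).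
Proof. unfold cell. cbn [lower]. rewrite psum_S. split; intros; lra. Qed.

Lemma cell_address (d : nat) (x : R) (N : nat) : (3 <= d)%nat -> 0 <= x < 1 -> cell d (address d x N) x.
Proof.
  intros Hd Hx. induction N as [|N IH]; [now apply cell_nil|].
  cbn [address]. apply cell_cons. apply slot_spec.
  unfold cell in IH. rewrite prefix_prob_split, length_address in IH by assumption.
  unfold psum. lra.
Qed.

(** Cells of valid lists of equal length are disjoint: a cell lies inside that of its tail, and
    [slot] recovers the last digit. *)
Lemma address_unique (d : nat) (x : R) (l : list nat) : (3 <= d)%nat -> valid d l -> cell d l x ->
  0 <= x < 1 /\ address d x (length l) = l.
Proof.
  intros Hd. induction l as [|a l IH]; intros Hv Hc.
  - split; [now apply cell_nil in Hc|reflexivity].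
  - destruct Hv as [Ha Hv]. apply cell_cons in Hc.
    assert (Hp : forall b, 0 <= prefix_prob d (b :: l)) by (intros; now apply prefix_prob_nonneg).
    destruct IH as [Hx E]; [assumption| |].
    + unfold cell. rewrite (prefix_prob_split d l) by assumption.
      assert (M0 := psum_mono _ 0 a Hp ltac:(lia)).
      assert (Mn := psum_mono _ (S a) (choices d (length l)) Hp ltac:(lia)).
      unfold psum at 1 in M0. simpl in M0. unfold psum in *. lra.
    + split; [assumption|]. simpl. rewrite E. f_equal. now apply slot_unique.
Qed.

Lemma cell_bounds (d : nat) (l : list nat) : (3 <= d)%nat -> valid d l ->
  0 <= lower d l /\ lower d l + prefix_prob d l <= 1.
Proof.
  intros Hd. induction l as [|a l IH]; intros Hv.
  - unfold prefix_prob. simpl. rewrite cyllim_nil by assumption. lra.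
  - destruct Hv as [Ha Hv]. destruct (IH Hv) as [H1 H2]. cbn [lower].
    assert (Hp : forall b, 0 <= prefix_prob d (b :: l)) by (intros; now apply prefix_prob_nonneg).
    rewrite (prefix_prob_split d l) in H2 by assumption.
    assert (M0 := psum_mono _ 0 a Hp ltac:(lia)).
    assert (Mn := psum_mono _ (S a) (choices d (length l)) Hp ltac:(lia)).
    rewrite psum_S in Mn. unfold psum at 1 in M0. simpl in M0. unfold psum in *. lra.
Qed.

(** The digit with index [code w] is the head of the address of length [S (code w)]. *)
Definition sample_value (d : nat) (x : R) (w : vertex) : nat :=
  if excluded_middle_informative (reduced d w) then hd 0%nat (address d x (S (code w))) else 0%nat.

Lemma config_of_address (d : nat) (x : R) (N : nat) (w : vertex) : reduced d w -> (code w < N)%nat ->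
  config_of (address d x N) w = sample_value d x w.
Proof.
  intros Hw. induction N as [|N IH]; intros H; [lia|].
  destruct (Nat.eq_dec (code w) N) as [E|E].
  - unfold sample_value. destruct excluded_middle_informative; [|contradiction]. rewrite E.
    cbn [address hd]. apply config_of_last. now rewrite length_address.
  - cbn [address]. rewrite config_of_earlier by (rewrite length_address; lia). apply IH. lia.
Qed.

Lemma sample_value_lt (d : nat) (x : R) (w : vertex) : (3 <= d)%nat -> reduced d w ->
  (sample_value d x w < d)%nat.
Proof.
  intros Hd Hw. unfold sample_value. destruct excluded_middle_informative; [|contradiction].
  assert (HV := valid_address d x (S (code w)) Hd). cbn [address valid hd] in *.
  destruct HV as [H _]. rewrite length_address in H.
  assert (E : choices d (code w) = d)
    by (unfold choices; now rewrite (proj2 (decode_some d (code w) w))).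
  eapply Nat.lt_le_trans; [exact H|now rewrite E].
Qed.

Lemma sample_value_out (d : nat) (x : R) (w : vertex) : ~ reduced d w -> sample_value d x w = 0%nat.
Proof.
  intros Hw. unfold sample_value. now destruct excluded_middle_informative.
Qed.

Definition sample (d : nat) (h3 : (3 <= d)%nat) (x : R) : Omega d :=
  exist _ (sample_value d x)
    (conj (fun w Hw => sample_value_lt d x w h3 Hw) (sample_value_out d x)).

Fixpoint values_below (d : nat) (xi : vertex -> nat) (N : nat) : list nat :=
  match N with
  | O => []
  | S N => match decode d N with Some w => xi w | None => 0%nat end :: values_below d xi N
  end.

Lemma length_values_below (d : nat) (xi : vertex -> nat) (N : nat) : length (values_below d xi N) = N.
Proof. induction N; simpl; congruence. Qed.

Lemma config_of_values_below (d : nat) (xi : vertex -> nat) (N : nat) (w : vertex) :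
  reduced d w -> (code w < N)%nat -> config_of (values_below d xi N) w = xi w.
Proof.
  intros Hw. induction N as [|N IH]; intros H; [lia|]. cbn [values_below].
  destruct (Nat.eq_dec (code w) N) as [E|E].
  - rewrite config_of_last by now rewrite length_values_below.
    now rewrite (proj2 (decode_some d N w)).
  - rewrite config_of_earlier by (rewrite length_values_below; lia). apply IH. lia.
Qed.

Lemma valid_values_below (d : nat) (xi : vertex -> nat) (N : nat) :
  (forall w, In w (coded_below d N) -> (xi w < d)%nat) -> valid d (values_below d xi N).
Proof.
  induction N as [|N IH]; intros H; [exact I|]. cbn [values_below valid].
  rewrite length_values_below. unfold choices. cbn [coded_below] in H.
  destruct (decode d N) as [w|].
  - split; [apply H; now left|apply IH; intros; apply H; now right].
  - split; [lia|auto].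
Qed.

Lemma sample_in_cylinder (d : nat) (h3 : (3 <= d)%nat) (xi : vertex -> nat) (N : nat) (x : R) :
  (forall w, In w (coded_below d N) -> (xi w < d)%nat) -> 0 <= x < 1 ->
  (cyl d (coded_below d N) xi (sample d h3 x) <-> cell d (values_below d xi N) x).
Proof.
  intros Hxi Hx. split.
  - intros H. replace (values_below d xi N) with (address d x N); [now apply cell_address|].
    assert (K : forall M, (M <= N)%nat -> address d x M = values_below d xi M).
    { induction M as [|M IH]; intros HM; [reflexivity|].
      assert (HV := valid_address d x (S M) h3). cbn [address values_below] in *.
      rewrite IH in * by lia. f_equal. destruct (decode d M) as [w|] eqn:E.
      - apply decode_some in E as E'. destruct E' as [Hw Ew].
        rewrite <- (H w) by (apply in_coded_below; split; [assumption|lia]). simpl.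
        unfold sample_value. destruct excluded_middle_informative; [|contradiction].
        rewrite Ew. cbn [address List.hd]. now rewrite IH by lia.
      (* A number that codes no vertex allows only the digit 0, the default in [values_below]. *)
      - cbn [valid] in HV. destruct HV as [HV _]. rewrite length_values_below in HV.
        assert (E1 : choices d M = 1%nat) by (unfold choices; now rewrite E).
        remember (slot _ _ _) as a. lia. }
    now apply K.
  - intros H w Hw. apply address_unique in H as [_ H]; auto using valid_values_below.
    rewrite length_values_below in H. apply in_coded_below in Hw as [Hw Hc]. simpl.
    rewrite <- (config_of_address d x N), H by assumption.
    now apply config_of_values_below.
Qed.

(** * The limit measure *)

Lemma pred_ext (T : Type) (S S' : T -> Prop) : (forall x, S x <-> S' x) -> S = S'.
Proof.
  intros H. apply functional_extensionality. intros x. apply propositional_extensionality, H.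
Qed.

(** The whole space is generated as the union of a coordinate event and its complement. *)
Lemma measurable_const (d : nat) (Q : Prop) : measurable d (fun _ => Q).
Proof.
  assert (HT : measurable d (fun _ => True)).
  { set (S := fun eta : Omega d => proj1_sig eta [] = 0%nat).
    assert (HS : measurable d S) by apply meas_coord.
    rewrite (pred_ext _ _ (fun eta : Omega d => exists n : nat, (match n with O => S | _ => fun e => ~ S e end) eta)).
    - apply (meas_union d (fun n => match n with O => S | _ => fun e => ~ S e end)).
      intros [|n]; [assumption|now constructor].
    - intros eta. split; [intros _|trivial].
      destruct (classic (S eta)); [now exists 0%nat|now exists 1%nat]. }
  destruct (classic Q) as [q|q].
  - rewrite (pred_ext _ _ (fun _ : Omega d => True)); [assumption|tauto].
  - rewrite (pred_ext _ _ (fun _ : Omega d => ~ True)); [now apply meas_compl|tauto].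
Qed.

Lemma measurable_or (d : nat) (S T : Omega d -> Prop) : measurable d S -> measurable d T ->
  measurable d (fun eta => S eta \/ T eta).
Proof.
  intros HS HT.
  rewrite (pred_ext _ _ (fun eta : Omega d => exists n : nat, (match n with O => S | _ => T end) eta)).
  - apply (meas_union d (fun n => match n with O => S | _ => T end)). now intros [|n].
  - intros eta. split.
    + intros [H|H]; [now exists 0%nat|now exists 1%nat].
    + intros [[|n] H]; auto.
Qed.

Lemma measurable_and (d : nat) (S T : Omega d -> Prop) : measurable d S -> measurable d T ->
  measurable d (fun eta => S eta /\ T eta).
Proof.
  intros HS HT. rewrite (pred_ext _ _ (fun eta : Omega d => ~ (~ S eta \/ ~ T eta))).
  - apply meas_compl, measurable_or; now apply meas_compl.
  - intros eta. split; [tauto|]. intros H. split; apply NNPP; tauto.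
Qed.

Lemma measurable_cyl (d : nat) (A : list vertex) (xi : vertex -> nat) : measurable d (cyl d A xi).
Proof.
  induction A as [|w A IH].
  - rewrite (pred_ext _ _ (fun _ : Omega d => True)); [apply measurable_const|].
    intros eta. split; [trivial|intros _ w []].
  - rewrite (pred_ext _ _ (fun eta : Omega d => proj1_sig eta w = xi w /\ cyl d A xi eta)).
    + apply measurable_and; [apply meas_coord|assumption].
    + intros eta. unfold cyl. split.
      * intros H. split; [apply H; now left|intros; apply H; now right].
      * intros [H1 H2] v [<-|Hv]; auto.
Qed.

Section Probability.
Context (d : nat) (mu : (Omega d -> Prop) -> R) (Hmu : is_probability d mu).

(** The empty set is a disjoint union of copies of itself, so the partial sums [(n + 1) mu]
    converge; their increments, all equal to its measure, tend to 0. *)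
Lemma prob_empty : mu (fun _ => False) = 0.
Proof.
  destruct Hmu as [_ [_ Hs]].
  specialize (Hs (fun _ _ => False) (fun _ => measurable_const d False) ltac:(tauto)).
  rewrite (pred_ext _ (fun _ => exists _ : nat, False) (fun _ => False)) in Hs by firstorder.
  assert (Hc : Un_cv (fun n => INR (S n) * mu (fun _ => False)) (mu (fun _ => False))).
  { apply Un_cv_ext with (sum_f_R0 (fun _ => mu (fun _ => False))); [|exact Hs].
    intros n. rewrite sum_cte. ring. }
  assert (Hc' : Un_cv (fun n => INR (S (S n)) * mu (fun _ => False)) (mu (fun _ => False))).
  { intros e He. destruct (Hc e He) as [N HN]. exists N. intros n Hn. apply (HN (S n)). lia. }
  assert (D := CV_minus _ _ _ _ Hc' Hc). rewrite Rminus_diag in D.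
  apply (UL_sequence (fun _ => mu (fun _ => False))); [apply Un_cv_const|].
  eapply Un_cv_ext; [|exact D]. intros n. cbv beta; rewrite !S_INR. ring.
Qed.

Lemma prob_or (S T : Omega d -> Prop) : measurable d S -> measurable d T ->
  (forall eta, S eta -> T eta -> False) -> mu (fun eta => S eta \/ T eta) = mu S + mu T.
Proof.
  intros HS HT Hd. destruct Hmu as [_ [_ Hs]].
  set (U := fun n : nat => match n with O => S | 1%nat => T | _ => fun _ => False end).
  assert (H : infinite_sum (fun n => mu (U n)) (mu (fun eta => exists n, U n eta))).
  { apply Hs.
    - intros [|[|n]]; simpl; auto. apply measurable_const.
    - intros [|[|i]] [|[|j]] eta Hij; simpl; intros; try contradiction; eauto. }
  rewrite (pred_ext _ _ (fun eta : Omega d => S eta \/ T eta)) in H.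
  - apply (UL_sequence (sum_f_R0 (fun n => mu (U n)))); [exact H|].
    apply Un_cv_eventually with (fun _ => mu S + mu T); [|apply Un_cv_const].
    exists 1%nat. intros n Hn. induction Hn as [|n Hn IH]; [reflexivity|].
    simpl. rewrite <- IH. destruct n as [|n]; [lia|]. simpl. rewrite prob_empty. ring.
  - intros eta. split.
    + intros [[|[|n]] Hn]; simpl in Hn; auto; contradiction.
    + intros [H1|H1]; [now exists 0%nat|now exists 1%nat].
Qed.

Lemma prob_compl (S : Omega d -> Prop) : measurable d S -> mu (fun eta => ~ S eta) = 1 - mu S.
Proof.
  intros HS. assert (E := prob_or S (fun eta => ~ S eta) HS (meas_compl d S HS) (fun eta H N => N H)).
  rewrite (pred_ext _ _ (fun _ : Omega d => True)) in E by (intros; split; [trivial|intros; apply classic]).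
  destruct Hmu as [_ [H1 _]]. lra.
Qed.

(** Induction over an upper bound [n] for the value at [w]; at [n = d] the bound holds on all of
    [Omega d]. *)
Lemma prob_cyl_split (A : list vertex) (xi : vertex -> nat) (w : vertex) : reduced d w -> ~ In w A ->
  mu (cyl d A xi) = Rsum (seq 0 d) (fun a => mu (cyl d (w :: A) (upd xi w a))).
Proof.
  intros Hw Hn.
  assert (E : forall eta a, cyl d (w :: A) (upd xi w a) eta <-> cyl d A xi eta /\ proj1_sig eta w = a).
  { intros eta a. unfold cyl. split.
    - intros H. split.
      + intros v Hv. rewrite (H v) by now right. apply upd_other. congruence.
      + rewrite (H w) by now left. apply upd_same.
    - intros [H1 H2] v [<-|Hv]; [now rewrite upd_same|].
      rewrite upd_other by congruence. auto. }
  assert (K : forall n, mu (fun eta => cyl d A xi eta /\ (proj1_sig eta w < n)%nat) =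
                        Rsum (seq 0 n) (fun a => mu (cyl d (w :: A) (upd xi w a)))).
  { induction n as [|n IH].
    - rewrite (pred_ext _ _ (fun _ : Omega d => False)); [apply prob_empty|]. intros; split; [lia|tauto].
    - rewrite seq_S, Rsum_app. simpl Nat.add. cbn [Rsum fold_right]. rewrite <- IH, Rplus_0_r.
      rewrite <- prob_or.
      + f_equal. apply pred_ext. intros eta. rewrite E.
        split; [intros [H1 H2]|intros [[H1 H2]|[H1 H2]]; split; auto; lia].
        destruct (Nat.eq_dec (proj1_sig eta w) n); [right; auto|left; split; auto; lia].
      + clear IH. induction n as [|n IH].
        * rewrite (pred_ext _ _ (fun _ : Omega d => False)); [apply measurable_const|].
          intros; split; [lia|tauto].
        * rewrite (pred_ext _ _ (fun eta : Omega d => (cyl d A xi eta /\ (proj1_sig eta w < n)%nat) \/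
             (cyl d A xi eta /\ proj1_sig eta w = n))).
          -- apply measurable_or; [assumption|].
             apply measurable_and; [apply measurable_cyl|apply meas_coord].
          -- intros eta. split; [intros [H1 H2]|intros [[H1 H2]|[H1 H2]]; split; auto; lia].
             destruct (Nat.eq_dec (proj1_sig eta w) n); [right; auto|left; split; auto; lia].
      + apply measurable_cyl.
      + intros eta [_ H1] H2. apply E in H2. lia. }
  rewrite <- K. f_equal. apply pred_ext. intros eta. split; [|tauto]. intros H. split; [assumption|].
  destruct eta as [eta [H1 H2]]. simpl. auto.
Qed.

End Probability.

Lemma cyl_ext (d : nat) (A B : list vertex) (xi zeta : vertex -> nat) : incl A B -> incl B A ->
  (forall w, In w A -> xi w = zeta w) -> cyl d A xi = cyl d B zeta.
Proof.
  intros HAB HBA H. apply pred_ext. intros eta. unfold cyl. split; intros K w Hw.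
  - rewrite <- H by auto. auto.
  - rewrite H by auto. auto.
Qed.

Lemma cylinder_probabilities (d : nat) (mu : (Omega d -> Prop) -> R) : (3 <= d)%nat ->
  is_probability d mu ->
  (forall N xi, mu (cyl d (coded_below d N) xi) = cyllim d (coded_below d N) xi) ->
  forall A xi, within d A -> mu (cyl d A xi) = cyllim d A xi.
Proof.
  intros Hd Hmu Hcoded A xi HA.
  assert (HN : exists N, incl A (coded_below d N)).
  { exists (S (list_max (map code A))). intros w Hw. apply in_coded_below. split; [auto|].
    assert (L := proj1 (list_max_le (map code A) _) (le_n _)). rewrite Forall_forall in L.
    specialize (L (code w) (in_map _ _ _ Hw)). lia. }
  destruct HN as [N HN].
  assert (K : forall B, within d B -> (forall xi, mu (cyl d (B ++ A) xi) = cyllim d (B ++ A) xi) ->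
              forall xi, mu (cyl d A xi) = cyllim d A xi).
  { induction B as [|w B IH]; intros HB H zeta; [apply H|]. apply IH; [intros v Hv; apply HB; now right|].
    clear zeta. intros zeta.
    assert (HBA : within d (B ++ A)).
    { intros v Hv. apply in_app_iff in Hv as [Hv|Hv]; [apply HB; now right|auto]. }
    destruct (in_dec (list_eq_dec Nat.eq_dec) w (B ++ A)) as [Hw|Hw].
    - assert (I1 : incl (B ++ A) ((w :: B) ++ A)) by (intros v Hv; now right).
      assert (I2 : incl ((w :: B) ++ A) (B ++ A)) by (intros v [<-|Hv]; auto).
      rewrite (cyl_ext d _ ((w :: B) ++ A) zeta zeta) by auto.
      rewrite (cyllim_ext d _ ((w :: B) ++ A) zeta zeta) by auto. apply H.
    - assert (Hwr : reduced d w) by (apply HB; now left).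
      rewrite (prob_cyl_split d mu Hmu _ zeta w), (cyllim_cons d _ zeta w) by auto.
      apply Rsum_ext. intros a _. apply H. }
  apply K with (coded_below d N); [apply within_coded_below|].
  intros zeta.
  assert (I1 : incl (coded_below d N ++ A) (coded_below d N)).
  { intros v Hv. apply in_app_iff in Hv as [Hv|Hv]; auto. }
  assert (I2 : incl (coded_below d N) (coded_below d N ++ A)) by (intros v Hv; apply in_app_iff; auto).
  rewrite (cyl_ext d _ (coded_below d N) zeta zeta) by auto.
  rewrite (cyllim_ext d _ (coded_below d N) zeta zeta); auto.
  intros v Hv. apply I1 in Hv. now apply within_coded_below in Hv.
Qed.

Lemma exists_limit_measure (d : nat) : (3 <= d)%nat ->
  exists nu : (Omega d -> Prop) -> R, is_probability d nu /\
    forall A xi, within d A -> nu (cyl d A xi) = cyllim d A xi.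
Proof.
  intros Hd.
  destruct UnitLebesgue.unit_lebesgue as (mes & mu & Hext & Hcompl & Hunion & Hitv & Hpos & Hlen & Hsig).
  set (nu := fun S : Omega d -> Prop => mu (fun x => S (sample d Hd x))).
  assert (Hempty : mes (fun _ => False)).
  { apply (Hext (fun x => 1 <= x < 0)); [intros; lra|apply Hitv]. }
  assert (Hfull : mes (fun _ => True)).
  { apply (Hext (fun x => ~ False)); [tauto|now apply Hcompl]. }
  assert (Hmeas : forall S, measurable d S -> mes (fun x => S (sample d Hd x))).
  { induction 1 as [w k|S HS IH|S HS IH].
    - simpl. destruct (classic (reduced d w)) as [Hw|Hw].
      (* The event is the union of the cells whose newest digit is [k]. Unions are indexed by [nat],
         so lists are numbered by [code]; a number that codes no such list contributes the empty
         set. *)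
      + apply (Hext (fun x => exists n : nat, exists l, code l = n /\ valid d l /\
                 length l = S (code w) /\ hd 0%nat l = k /\ cell d l x)).
        * intros x Hx. unfold sample_value. destruct excluded_middle_informative; [|contradiction].
          split.
          -- intros [n [l [_ [Hv [Hl [Hk Hc]]]]]]. apply address_unique in Hc as [_ E]; auto.
             now rewrite <- Hl, E.
          -- intros Hk. exists (code (address d x (S (code w)))), (address d x (S (code w))).
             split; [reflexivity|]. split; [now apply valid_address|].
             split; [apply length_address|]. split; [assumption|now apply cell_address].
        * apply Hunion. intros n.
          destruct (classic (exists l, code l = n /\ valid d l /\ length l = S (code w) /\ hd 0%nat l = k))
            as [[l [H1 [H2 [H3 H4]]]]|N].
          -- apply (Hext (cell d l)); [|apply Hitv]. intros x _. split; [intros Hc; exists l; auto|].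
             intros [l' [E1 [_ [_ [_ Hc]]]]]. replace l with l'; [assumption|].
             apply code_inj. congruence.
          -- apply (Hext (fun _ => False)); [|assumption]. intros x _. split; [tauto|].
             intros [l [H1 [H2 [H3 [H4 _]]]]]. apply N. exists l. auto.
      + destruct (Nat.eq_dec k 0) as [->|Hk].
        * apply (Hext (fun _ => True)); [|assumption]. intros x _.
          rewrite sample_value_out by assumption. tauto.
        * apply (Hext (fun _ => False)); [|assumption]. intros x _.
          rewrite sample_value_out by assumption. split; [tauto|congruence].
    - now apply (Hcompl (fun x => S (sample d Hd x))).
    - now apply (Hunion (fun n x => S n (sample d Hd x))). }
  assert (Hprob : is_probability d nu).
  { split; [|split].
    - intros S HS. apply Hpos. now apply Hmeas.
    - unfold nu. destruct (Hext (fun _ => True) (fun x => 0 <= x < 1)) as [_ ->]; [tauto|].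
      rewrite Hlen; lra.
    - intros S HS Hdis. apply (Hsig (fun n x => S n (sample d Hd x))).
      + intros n. now apply Hmeas.
      + intros i j x Hij. now apply Hdis. }
  exists nu. split; [assumption|]. apply cylinder_probabilities; auto.
  intros N xi. unfold nu.
  destruct (classic (exists w, In w (coded_below d N) /\ (d <= xi w)%nat)) as [[w [Hw Hxi]]|Hxi].
  (* A prescribed value of at least [d] is impossible; the event is replaced by the empty interval
     [0, 0). *)
  - rewrite (cyllim_zero d _ xi w); auto using within_coded_below.
    destruct (Hext (fun x => cyl d (coded_below d N) xi (sample d Hd x)) (fun x => 0 <= x < 0)) as [_ ->].
    + intros x _. split; [|lra]. intros H. specialize (H w Hw). simpl in H.
      apply within_coded_below in Hw. assert (L := sample_value_lt d x w Hd Hw). lia.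
    + rewrite Hlen; lra.
  - assert (Hlt : forall w, In w (coded_below d N) -> (xi w < d)%nat).
    { intros w Hw. apply Nat.nle_gt. intros L. apply Hxi. eauto. }
    assert (Hv := valid_values_below d xi N Hlt).
    destruct (Hext (fun x => cyl d (coded_below d N) xi (sample d Hd x)) (cell d (values_below d xi N)))
      as [_ ->].
    + intros x Hx. now apply sample_in_cylinder.
    + destruct (cell_bounds d (values_below d xi N) Hd Hv) as [B1 B2].
      assert (B3 := prefix_prob_nonneg d (values_below d xi N) Hd).
      unfold cell. rewrite Hlen by lra. unfold Rminus.
      rewrite (Rplus_comm (lower _ _)), Rplus_assoc, Rplus_opp_r, Rplus_0_r.
      unfold prefix_prob. rewrite length_values_below.
      apply cyllim_ext; auto using incl_refl, within_coded_below.
      intros w Hw. apply in_coded_below in Hw as [H1 H2]. now apply config_of_values_below.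
Qed.

(* The Dynkin class generated by cylinders; being closed under intersections, it is the whole
   sigma-algebra. *)
Inductive dynkin (d : nat) : (Omega d -> Prop) -> Prop :=
| dynkin_cyl : forall A xi, within d A -> dynkin d (cyl d A xi)
| dynkin_compl : forall S, dynkin d S -> dynkin d (fun eta => ~ S eta)
| dynkin_union : forall S : nat -> Omega d -> Prop, (forall n, dynkin d (S n)) ->
    (forall i j eta, i <> j -> S i eta -> S j eta -> False) ->
    dynkin d (fun eta => exists n, S n eta).

Lemma dynkin_measurable (d : nat) (S : Omega d -> Prop) : dynkin d S -> measurable d S.
Proof. induction 1; [apply measurable_cyl|now constructor|now constructor]. Qed.

Lemma dynkin_const (d : nat) (Q : Prop) : dynkin d (fun _ => Q).
Proof.
  assert (HT : dynkin d (fun _ => True)).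
  { rewrite (pred_ext (Omega d) _ (cyl d [] (fun _ => 0%nat))); [apply dynkin_cyl; intros ? []|].
    intros eta. split; [intros _ w []|trivial]. }
  destruct (classic Q) as [q|q].
  - rewrite (pred_ext _ _ (fun _ : Omega d => True)); [assumption|tauto].
  - rewrite (pred_ext _ _ (fun _ : Omega d => ~ True)); [now apply dynkin_compl|tauto].
Qed.

Lemma dynkin_or (d : nat) (S T : Omega d -> Prop) : dynkin d S -> dynkin d T ->
  (forall eta, S eta -> T eta -> False) -> dynkin d (fun eta => S eta \/ T eta).
Proof.
  intros HS HT Hd.
  set (U := fun n : nat => match n with O => S | 1%nat => T | _ => fun _ => False end).
  rewrite (pred_ext _ _ (fun eta : Omega d => exists n : nat, U n eta)).
  - apply dynkin_union.
    + intros [|[|n]]; simpl; auto. apply dynkin_const.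
    + intros [|[|i]] [|[|j]] eta Hij; simpl; intros; try contradiction; eauto.
  - intros eta. split.
    + intros [H|H]; [now exists 0%nat|now exists 1%nat].
    + intros [[|[|n]] H]; simpl in H; auto; contradiction.
Qed.

(** The sets whose intersection with [C] is in the class form a Dynkin class. For complements, [C]
    minus [S] is the complement of the disjoint union of [S] intersected with [C] and the complement
    of [C]. *)
Lemma dynkin_inter_fixed (d : nat) (C : Omega d -> Prop) : dynkin d C ->
  (forall A xi, within d A -> dynkin d (fun eta => cyl d A xi eta /\ C eta)) ->
  forall S, dynkin d S -> dynkin d (fun eta => S eta /\ C eta).
Proof.
  intros HC Hcyl S HS. induction HS as [A xi HA|S HS IH|S HS IH Hdis]; [auto| |].
  - rewrite (pred_ext _ _ (fun eta : Omega d => ~ ((S eta /\ C eta) \/ ~ C eta))).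
    + apply dynkin_compl, dynkin_or; [assumption|now apply dynkin_compl|tauto].
    + intros eta. split; [tauto|]. intros H. split; [tauto|]. apply NNPP. tauto.
  - rewrite (pred_ext _ _ (fun eta : Omega d => exists n, S n eta /\ C eta)) by firstorder.
    apply (dynkin_union d (fun n eta => S n eta /\ C eta)); [assumption|].
    intros i j eta Hij [H1 _] [H2 _]. eauto.
Qed.

(** Two applications of [dynkin_inter_fixed] reduce this to two cylinders, whose intersection is a
    cylinder over [A ++ B] if the prescribed values are compatible and empty otherwise. *)
Lemma dynkin_inter (d : nat) (S T : Omega d -> Prop) : dynkin d S -> dynkin d T ->
  dynkin d (fun eta => S eta /\ T eta).
Proof.
  intros HS HT. revert S HS. apply dynkin_inter_fixed; [assumption|].
  intros A xi HA. rewrite (pred_ext _ _ (fun eta : Omega d => T eta /\ cyl d A xi eta)) by tauto.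
  revert T HT. apply dynkin_inter_fixed; [now apply dynkin_cyl|].
  intros B zeta HB.
  destruct (classic (forall w, In w A -> In w B -> xi w = zeta w)) as [H|H].
  - rewrite (pred_ext (Omega d) _ (cyl d (A ++ B) (fun w => if inVb A w then xi w else zeta w))).
    + apply dynkin_cyl. intros w Hw. apply in_app_iff in Hw as [Hw|Hw]; auto.
    + intros eta. unfold cyl. split.
      * intros [H1 H2] w Hw. destruct (inVb A w) eqn:E; [apply H2; now apply inVb_iff|].
        apply inVb_false in E. apply H1. apply in_app_iff in Hw. tauto.
      * intros H1. split; intros w Hw;
          (assert (HwAB : In w (A ++ B)) by (apply in_app_iff; tauto)); specialize (H1 w HwAB);
          destruct (inVb A w) eqn:E; auto.
        -- apply inVb_iff in E. now rewrite <- H.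
        -- apply inVb_false in E. contradiction.
  - rewrite (pred_ext _ _ (fun _ : Omega d => False)); [apply dynkin_const|].
    intros eta. split; [|tauto]. intros [H1 H2]. apply H. intros w HwA HwB.
    rewrite <- (H2 w HwA). apply (H1 w HwB).
Qed.

Lemma measurable_dynkin (d : nat) (S : Omega d -> Prop) : measurable d S -> dynkin d S.
Proof.
  induction 1 as [w k|S HS IH|S HS IH].
  - destruct (classic (reduced d w)) as [Hw|Hw].
    + rewrite (pred_ext (Omega d) _ (cyl d [w] (fun _ => k))).
      * apply dynkin_cyl. intros v [<-|[]]. assumption.
      * intros eta. unfold cyl. split; [intros H v [<-|[]]; assumption|]. intros H. apply (H w). now left.
    (* Off the reduced words every element of [Omega d] is 0, so the event is constant. *)
    + rewrite (pred_ext _ _ (fun _ : Omega d => 0%nat = k)); [apply dynkin_const|].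
      intros [eta [H1 H2]]. simpl. now rewrite H2.
  - now apply dynkin_compl.
  (* An arbitrary union is made disjoint by the first index at which it holds, which requires
     closure under intersections. *)
  - assert (Hno : forall n, dynkin d (fun eta => forall m, (m < n)%nat -> ~ S m eta)).
    { induction n as [|n IHn].
      - rewrite (pred_ext _ _ (fun _ : Omega d => True)); [apply dynkin_const|]. intros; split; [trivial|lia].
      - rewrite (pred_ext _ _ (fun eta : Omega d => (forall m, (m < n)%nat -> ~ S m eta) /\ ~ S n eta)).
        + apply dynkin_inter; [assumption|]. now apply dynkin_compl.
        + intros eta. split.
          * intros H. split; [intros m Hm|]; apply H; lia.
          * intros [H1 H2] m Hm. destruct (Nat.eq_dec m n) as [->|]; [assumption|]. apply H1. lia. }
    rewrite (pred_ext _ _ (fun eta : Omega d => exists n, S n eta /\ forall m, (m < n)%nat -> ~ S m eta)).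
    + apply (dynkin_union d (fun n eta => S n eta /\ forall m, (m < n)%nat -> ~ S m eta)).
      * intros n. now apply dynkin_inter.
      * intros i j eta Hij [H1 H2] [H3 H4]. destruct (Nat.lt_trichotomy i j) as [L|[L|L]].
        -- now apply (H4 i).
        -- contradiction.
        -- now apply (H2 j).
    + intros eta. split; [|firstorder]. intros [n Hn].
      destruct (dec_inh_nat_subset_has_unique_least_element (fun n => S n eta)) as [m [[H1 H2] _]].
      * intros m. apply classic.
      * now exists n.
      * exists m. split; [assumption|]. intros k Hk Sk. specialize (H2 k Sk). lia.
Qed.

Lemma prob_determined (d : nat) (mu nu : (Omega d -> Prop) -> R) :
  is_probability d mu -> is_probability d nu ->
  (forall A xi, within d A -> mu (cyl d A xi) = nu (cyl d A xi)) ->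
  forall S, measurable d S -> mu S = nu S.
Proof.
  intros Hmu Hnu Hcyl S HS. apply measurable_dynkin in HS.
  induction HS as [A xi HA|S HS IH|S HS IH Hdis].
  - auto.
  - apply dynkin_measurable in HS. rewrite (prob_compl d mu), (prob_compl d nu), IH; auto.
  - assert (HM : forall n, measurable d (S n)) by (intros; now apply dynkin_measurable).
    destruct Hmu as [_ [_ Hmu]]. destruct Hnu as [_ [_ Hnu]].
    apply (UL_sequence (sum_f_R0 (fun n => nu (S n)))).
    + rewrite <- (functional_extensionality (fun n => mu (S n)) (fun n => nu (S n)) IH).
      apply Hmu; auto.
    + apply Hnu; auto.
Qed.

Lemma unif_cyl_unique (Rset : (vertex -> nat) -> Prop) (A : list vertex) (xi : vertex -> nat) (p q : R) :
  unif_cyl Rset A xi p -> unif_cyl Rset A xi q -> p = q.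
Proof.
  intros [L [ND [HL ->]]] [L' [ND' [HL' ->]]].
  assert (K : forall M M' : list (vertex -> nat), NoDup M -> NoDup M' ->
    (forall eta, In eta M <-> In eta M') -> length M = length M').
  { intros M M' N N' H. apply Permutation_length. now apply NoDup_Permutation. }
  rewrite (K L L'), (K (filter (fun eta => agreeb A eta xi) L) (filter (fun eta => agreeb A eta xi) L'));
    auto using NoDup_filter; intros eta; rewrite ?filter_In, HL, HL'; tauto.
Qed.

Theorem theorem8p1 (d : nat) (hd : (3 <= d)%nat) :
  exists nu : (Omega d -> Prop) -> R,
    is_probability d nu /\
    (forall V, exhaustion d V -> sandpile_converges d V nu) /\
    (forall nu' : (Omega d -> Prop) -> R, is_probability d nu' ->
       (exists V, exhaustion d V /\ sandpile_converges d V nu') ->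
       forall S, measurable d S -> nu' S = nu S).
Proof.
  destruct (exists_limit_measure d hd) as [nu [Hnu Hcyl]].
  assert (Hp : forall V A xi, exhaustion d V -> within d A ->
    (forall n, unif_cyl (recurrent d (V n)) A xi (cylprob d (n + depth (V n)) (V n) A xi)) /\
    Un_cv (fun n => cylprob d (n + depth (V n)) (V n) A xi) (nu (cyl d A xi))).
  { intros V A xi HV HA. split.
    - intros n. apply unif_cyl_cylprob; [assumption| |apply deep_depth].
      destruct HV as [HV _]. intros w. apply HV.
    - rewrite Hcyl by assumption. now apply cylprob_cv. }
  exists nu. split; [assumption|]. split.
  - intros V HV A xi HA. exists (fun n => cylprob d (n + depth (V n)) (V n) A xi). now apply Hp.
  (* Convergence along a single exhaustion already fixes all cylinder probabilities of [nu']. *)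
  - intros nu' Hnu' [V [HV Hconv]]. apply prob_determined; auto. intros A xi HA.
    destruct (Hconv A xi HA) as [p [Hp1 Hp2]]. destruct (Hp V A xi HV HA) as [Hq1 Hq2].
    apply (UL_sequence p); [assumption|].
    eapply Un_cv_ext; [|exact Hq2]. intros n. simpl. eapply unif_cyl_unique; eauto.
Qed.
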